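(* Let $G\in H^\infty_{m\times p}$ be such that $T_GT_G^*$ is strictly positive. Let $\Xi(z)=Y(z)\Xi_0$ and $\Theta(z)=Y(z)\Theta_0$ for $z\in\mathbb{D}$, where $\Xi_0$, $\Theta_0$ and $Y$ are the matrices and the function associated with $G$ as defined in the context. Then $\Xi\in H^2_{p\times m}$, $\Theta\in H^\infty_{p\times(p-m)}$ is inner with $\operatorname{Im} T_\Theta=\operatorname{Ker} T_G$, and for any $V\in H^2_{(p-m)\times m}$ the function $$X(z)=\Xi(z)+\Theta(z)V(z)\quad (z\in\mathbb{D})$$ is a solution to the $H^2$-Bezout problem associated with $G$. Moreover, all solutions are obtained in this way. Furthermore, for $X$ given by this formula, with $V$ in $H^2_{(p-m)\times m}$, we have $$\|X(\cdot)u\|^2_{H^2_p}=\|\Xi(\cdot)u\|^2_{H^2_p}+\|V(\cdot)u\|^2_{H^2_{p-m}}\quad (u\in\mathbb{C}^m).$$ In particular, $\Xi$ is the least squares solution to the $H^2$-Bezout problem associated with $G$.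
   Context: $\mathbb{D}$ is the open unit disc, $\mathbb{T}$ the unit circle. $H^\infty_{r\times s}$ and $H^2_{r\times s}$ are the spaces of $r\times s$ matrices with entries in $H^\infty$, respectively $H^2$, of $\mathbb{D}$; $H^2_r$ is the space of $\mathbb{C}^r$-valued $H^2$ functions, with norm the square root of the sum of squared norms of the Taylor coefficients. $\ell^2_+(\mathbb{C}^n)$ is the space of square summable sequences in $\mathbb{C}^n$ indexed by $0,1,2,\ldots$ For $F\in H^\infty_{r\times s}$ with Taylor coefficients $F_0,F_1,\ldots$ at zero, $T_F:\ell^2_+(\mathbb{C}^s)\to\ell^2_+(\mathbb{C}^r)$ is the analytic Toeplitz operator whose $(i,j)$ block entry ($i,j\ge0$) is $F_{i-j}$ if $i\ge j$ and $0$ otherwise, and $H_F:\ell^2_+(\mathbb{C}^s)\to\ell^2_+(\mathbb{C}^r)$ is the Hankel operator whose $(i,j)$ block entry is $F_{i+j+1}$. A selfadjoint operator is strictly positive if it is $\ge\delta I$ for some $\delta>0$. $F$ is inner if $T_F$ is an isometry (equivalently, $F(\zeta)^*F(\zeta)=I$ for a.e. $\zeta\in\mathbb{T}$). $S_n$ is the block forward shift on $\ell^2_+(\mathbb{C}^n)$, and $E_n=\begin{bmatrix}I_n&0&0&\cdots\end{bmatrix}^\top:\mathbb{C}^n\to\ell^2_+(\mathbb{C}^n)$ is the embedding onto the first coordinate space. For $G\in H^\infty_{m\times p}$ with $T_GT_G^*$ strictly positive define: - $\Xi_0=E_p^*T_G^*(T_GT_G^* )^{-1}E_m$, a $p\times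 m$ matrix; - $\Theta_0$, a $p\times k$ matrix with $\Theta_0\Theta_0^*=I_p-E_p^*T_G^*(T_GT_G^* )^{-1}T_GE_p$ and $\operatorname{Ker}\Theta_0=\{0\}$ (so $k$ is the rank of the right hand side; $\Theta_0$ is determined up to right multiplication by a unitary matrix, and any fixed choice is allowed); - $Y(z)=I_p-zE_p^*(I-zS_p^* )^{-1}T_G^*(T_GT_G^* )^{-1}H_GE_p$ for $z\in\mathbb{D}$, a $p\times p$ matrix function. The $H^2$-Bezout problem associated with $G$ is to find $X\in H^2_{p\times m}$ with $G(z)X(z)=I_m$ for all $z\in\mathbb{D}$; such $X$ is called a solution. The least squares solution is the solution $\Xi$ such that $\|\Xi(\cdot)u\|_{H^2_p}\le\|X(\cdot)u\|_{H^2_p}$ for every solution $X$ and every $u\in\mathbb{C}^m$. *)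

(* Defs.v *)
From HB Require Import structures.
From mathcomp Require Import all_boot all_order all_algebra.
From mathcomp Require Import all_classical all_reals all_analysis.
From mathcomp Require Export complex.

Set Implicit Arguments.
Unset Strict Implicit.
Unset Printing Implicit Defensive.

Import Order.TTheory GRing.Theory Num.Theory.
Import numFieldNormedType.Exports.

Local Open Scope classical_set_scope.
Local Open Scope ring_scope.
Local Open Scope sesquilinear_scope.

(* The scalar field is a generic [C : numClosedFieldType], because this is
   where the canonical topology given by the norm is available; the intended
   instance is [R[i]] with [R : realType].  Norms and inner products take
   values in [C], whose order is "y - x is a nonnegative real". *)

(* Operators are functions on all sequences; only their values on square
   summable sequences are relevant. *)

Definition vdot {C : numClosedFieldType} {n : nat} (u v : 'cV[C]_n) : C :=
  (v ^t* *m u) ord0 ord0.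

Definition l2 {C : numClosedFieldType} {n : nat} : set (nat -> 'cV[C]_n) :=
  [set x | cvgn (series (fun k => vdot (x k) (x k)))].

Definition l2dot {C : numClosedFieldType} {n : nat} (x y : nat -> 'cV[C]_n)
  : C := limn (series (fun k => vdot (x k) (y k))).

Definition l2norm {C : numClosedFieldType} {n : nat} (x : nat -> 'cV[C]_n)
  : C := sqrtC (l2dot x x).

Definition is_adjoint {C : numClosedFieldType} {s r : nat}
    (A : (nat -> 'cV[C]_s) -> (nat -> 'cV[C]_r))
    (B : (nat -> 'cV[C]_r) -> (nat -> 'cV[C]_s)) : Prop :=
  (forall y, l2 y -> l2 (B y)) /\
  (forall x y, l2 x -> l2 y -> l2dot (A x) y = l2dot x (B y)).

(* For a bounded operator, [adj A] and (if it exists) [opinv A] are uniquely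
   determined on [l2]. *)
Definition adj {C : numClosedFieldType} {s r : nat}
    (A : (nat -> 'cV[C]_s) -> (nat -> 'cV[C]_r))
    : (nat -> 'cV[C]_r) -> (nat -> 'cV[C]_s) :=
  xget (fun _ _ => 0) [set B | is_adjoint A B].

Definition is_inverse {C : numClosedFieldType} {n : nat}
    (A B : (nat -> 'cV[C]_n) -> (nat -> 'cV[C]_n)) : Prop :=
  forall x, l2 x -> [/\ l2 (B x), A (B x) = x & B (A x) = x].

Definition opinv {C : numClosedFieldType} {n : nat}
    (A : (nat -> 'cV[C]_n) -> (nat -> 'cV[C]_n))
    : (nat -> 'cV[C]_n) -> (nat -> 'cV[C]_n) :=
  xget (fun _ _ => 0) [set B | is_inverse A B].

Definition strictly_positive {C : numClosedFieldType} {n : nat}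
    (A : (nat -> 'cV[C]_n) -> (nat -> 'cV[C]_n)) : Prop :=
  is_adjoint A A /\
  exists2 delta : C, 0 < delta &
    forall x, l2 x -> delta * l2dot x x <= l2dot (A x) x.

Definition isometry_l2 {C : numClosedFieldType} {s r : nat}
    (A : (nat -> 'cV[C]_s) -> (nat -> 'cV[C]_r)) : Prop :=
  forall x, l2 x -> l2 (A x) /\ l2norm (A x) = l2norm x.

Definition shift {C : numClosedFieldType} {n : nat} (x : nat -> 'cV[C]_n)
  : nat -> 'cV[C]_n := fun k => if k is j.+1 then x j else 0.

(* [embed] is E_n and [coembed] its adjoint E_n^*, by [l2dot_embed]. *)
Definition embed {C : numClosedFieldType} {n : nat} (u : 'cV[C]_n)
  : nat -> 'cV[C]_n := fun k => if k is 0%N then u else 0.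

Definition coembed {C : numClosedFieldType} {n : nat} (x : nat -> 'cV[C]_n)
  : 'cV[C]_n := x 0%N.

Lemma l2dot_embed {C : numClosedFieldType} {n : nat} (u : 'cV[C]_n)
    (x : nat -> 'cV[C]_n) : l2dot (embed u) x = vdot u (coembed x).
Proof.
apply: cvg_lim => //; apply: cvg_near_cst; exists 1%N => // k /= k_gt0.
rewrite seriesEnat /= -(prednK k_gt0) big_nat_recl //= big1 ?addr0 //.
by move=> i _; rewrite /vdot mulmx0 mxE.
Qed.

(* The matrix of a linear map, columns being the images of the basis. *)
Definition mx_of {C : numClosedFieldType} {s r : nat}
    (f : 'cV[C]_s -> 'cV[C]_r) : 'M[C]_(r, s) :=
  \matrix_(i, j) f (delta_mx j ord0) i ord0.

(* Functions on the open unit disc are represented by functions on all of [C];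
   only their values on the disc are relevant.  The power series coefficients
   of an analytic function on the disc are unique, which makes [taylor]
   well defined. *)

Definition has_taylor {C : numClosedFieldType} (f : C -> C) (a : nat -> C)
  : Prop :=
  forall z : C, `|z| < 1 -> series (fun n => a n * z ^+ n) @ \oo --> f z.

Definition analytic {C : numClosedFieldType} (f : C -> C) : Prop :=
  exists a, has_taylor f a.

Definition taylor {C : numClosedFieldType} (f : C -> C) : nat -> C :=
  xget (fun=> 0) [set a | has_taylor f a].

Definition H2 {C : numClosedFieldType} (f : C -> C) : Prop :=
  analytic f /\ cvgn (series (fun n => `|taylor f n| ^+ 2)).

Definition Hinf {C : numClosedFieldType} (f : C -> C) : Prop :=
  analytic f /\ exists M : C, forall z, `|z| < 1 -> `|f z| <= M.

Definition H2mx {C : numClosedFieldType} {r s : nat} (F : C -> 'M[C]_(r, s))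
  : Prop := forall i j, H2 (fun z => F z i j).

Definition Hinfmx {C : numClosedFieldType} {r s : nat} (F : C -> 'M[C]_(r, s))
  : Prop := forall i j, Hinf (fun z => F z i j).

Definition mxtaylor {C : numClosedFieldType} {r s : nat}
    (F : C -> 'M[C]_(r, s)) (n : nat) : 'M[C]_(r, s) :=
  \matrix_(i, j) taylor (fun z => F z i j) n.

Definition h2norm {C : numClosedFieldType} {r : nat} (h : C -> 'cV[C]_r) : C :=
  l2norm (mxtaylor h).

Definition toeplitz {C : numClosedFieldType} {r s : nat}
    (F : C -> 'M[C]_(r, s)) (x : nat -> 'cV[C]_s) : nat -> 'cV[C]_r :=
  fun i => \sum_(j < i.+1) mxtaylor F (i - j) *m x j.

Definition hankel {C : numClosedFieldType} {r s : nat}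
    (F : C -> 'M[C]_(r, s)) (x : nat -> 'cV[C]_s) : nat -> 'cV[C]_r :=
  fun i => \col_l limn (series (fun j => (mxtaylor F (i + j).+1 *m x j) l ord0)).

Definition inner {C : numClosedFieldType} {r s : nat} (F : C -> 'M[C]_(r, s))
  : Prop := Hinfmx F /\ isometry_l2 (toeplitz F).

(* T_G T_G^* *)
Definition gram {C : numClosedFieldType} {m p : nat} (G : C -> 'M[C]_(m, p))
  : (nat -> 'cV[C]_m) -> (nat -> 'cV[C]_m) := toeplitz G \o adj (toeplitz G).

(* T_G^* (T_G T_G^* )^-1 *)
Definition toeplitz_rinv {C : numClosedFieldType} {m p : nat}
    (G : C -> 'M[C]_(m, p)) : (nat -> 'cV[C]_m) -> (nat -> 'cV[C]_p) :=
  adj (toeplitz G) \o opinv (gram G).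

Definition Xi0 {C : numClosedFieldType} {m p : nat} (G : C -> 'M[C]_(m, p))
  : 'M[C]_(p, m) := mx_of (coembed \o toeplitz_rinv G \o embed).

Definition is_Theta0 {C : numClosedFieldType} {m p k : nat}
    (G : C -> 'M[C]_(m, p)) (Theta0 : 'M[C]_(p, k)) : Prop :=
  Theta0 *m Theta0 ^t* =
    1%:M - mx_of (coembed \o toeplitz_rinv G \o toeplitz G \o embed) /\
  (forall u : 'cV[C]_k, Theta0 *m u = 0 -> u = 0).

(* (I - z S_n^* )^-1 *)
Definition coshift_resolvent {C : numClosedFieldType} {n : nat} (z : C)
  : (nat -> 'cV[C]_n) -> (nat -> 'cV[C]_n) :=
  opinv (fun x k => x k - z *: adj shift x k).

Definition Y {C : numClosedFieldType} {m p : nat} (G : C -> 'M[C]_(m, p))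
    (z : C) : 'M[C]_p :=
  1%:M - z *: mx_of (coembed \o coshift_resolvent z \o toeplitz_rinv G
                       \o hankel G \o embed).

Definition bezout_solution {C : numClosedFieldType} {m p : nat}
    (G : C -> 'M[C]_(m, p)) (X : C -> 'M[C]_(p, m)) : Prop :=
  H2mx X /\ forall z, `|z| < 1 -> G z *m X z = 1%:M.

Definition least_squares_solution {C : numClosedFieldType} {m p : nat}
    (G : C -> 'M[C]_(m, p)) (Xi : C -> 'M[C]_(p, m)) : Prop :=
  bezout_solution G Xi /\
  forall X, bezout_solution G X -> forall u : 'cV[C]_m,
    h2norm (fun z => Xi z *m u) <= h2norm (fun z => X z *m u).

(* Main.v *)
Require Import Defs.
From HB Require Import structures.
From mathcomp Require Import all_boot all_order all_algebra.
From mathcomp Require Import all_classical all_reals all_analysis.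
From mathcomp Require Import ring.
Import Order.TTheory GRing.Theory Num.Theory.
Import numFieldNormedType.Exports.
Local Open Scope classical_set_scope.
Local Open Scope ring_scope.

Set Implicit Arguments.
Unset Strict Implicit.
Unset Printing Implicit Defensive.

(** Write T for the analytic Toeplitz operator of G, which acts on coefficient
    sequences by convolution, T* for its adjoint, S for the forward shift, E for
    the embedding of constants, and R = T* (T T* )^-1, a right inverse of T.

    The symbol Y is designed so that the sequence Y u = E u - S R S* T E u
    satisfies T (Y u) = E (G(0) u) ([conv_Ycol]).  Conversely a sequence r whose
    tail S* r lies in Im T*, and for which T r is constant, is determined by its
    value at 0: R T is the identity on Im T*, so S* r = R T S* r, while T S* r
    is expressed by r(0); this gives r = Y r(0) ([Ycol_recover]).  As T* commutes
    with S*, the lemma applies to two families of sequences.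

    The first is r = R E u, the solution of T r = E u orthogonal to Ker T; hence
    the coefficients of Xi u are R E u, and Xi is the least squares solution.
    The second is q u = E u - R T E u, the projection of E u on Ker T, which has
    q u = Y Theta0 Theta0* u.  For y in Ker T the inner product of y and q u only
    sees y(0).  Since S maps Ker T into itself, the columns of Theta therefore
    form a wandering subspace: they lie in Ker T, have the norm of their
    argument, and are orthogonal to every sequence of Ker T vanishing at 0.  So
    T_Theta is isometric ([conv_Theta_isometry]), and peeling off one coefficient
    after the other shows that it maps onto Ker T ([conv_Theta_onto]).
    Evaluating at 0, Im Theta0 = Ker G(0), where G(0) is onto because
    G(0) Xi0 = I; this gives the size p - m of Theta ([Theta_size]).

    Solutions of the Bezout problem are the X with T X u = E u, that is, with
    X u - R E u in Ker T = Im T_Theta.  The parametrization follows, and the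
    norm identity is Pythagoras' theorem for Im T* and Ker T ([pythagoras]).

    The analysis behind this is as follows.  The inverse of T T* and the
    resolvent of S* exist by a Lax-Milgram theorem on l2 ([lax_milgram]).  The
    columns of G are square summable since bounded analytic functions are
    ([Hinf_square_summable], by Parseval's identity on roots of unity).  Products
    of functions correspond to convolutions of coefficients by Mertens' theorem
    ([cvg_series_conv]).  Theta is bounded because an isometric Toeplitz operator
    has a symbol bounded by 1 ([isometry_entry_le]).

    All of this is done over a numerical closed field whose order is complete, of
    which the complex numbers are an instance ([complex_order_complete]). *)

(** * Limits in an order complete field *)

(** This is the least upper bound property of the real elements, phrased inside
    the field so that no separate type of real numbers is needed. *)
Definition order_complete (C : numClosedFieldType) : Prop :=
  forall A : set C, A !=set0 -> (forall x, A x -> 0 <= x) ->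
    (exists M, forall x, A x -> x <= M) ->
  exists s, (forall x, A x -> x <= s) /\
            (forall M, (forall x, A x -> x <= M) -> s <= M).

Section Limits.
Variable C : numClosedFieldType.
Implicit Types (u v : nat -> C) (e q z K M : C).

Lemma cvgn_unique {u} {l l' : C} : u @ \oo --> l -> u @ \oo --> l' -> l = l'.
Proof. exact: cvg_unique. Qed.

Lemma cvg_ge0 {u} {l : C} : u @ \oo --> l -> (forall n, 0 <= u n) -> 0 <= l.
Proof.
move=> ul u0; suff -> : l = `|l| by [].
apply: (cvg_unique _ ul) => //.
have -> : u = (fun n => `|u n|) by apply/funext => n; rewrite ger0_norm.
exact: cvg_norm.
Qed.

Lemma cvg_ext {u v} {l : C} : u @ \oo --> l -> (forall n, u n = v n) ->
  v @ \oo --> l.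
Proof. by move=> + uv; have -> : u = v by apply/funext. Qed.

Lemma cvg_ler {u v} {a b : C} : u @ \oo --> a -> v @ \oo --> b ->
  (forall n, u n <= v n) -> a <= b.
Proof.
move=> ua vb uv; rewrite -subr_ge0.
by apply: (cvg_ge0 (cvgB vb ua)) => n; rewrite subr_ge0.
Qed.

Lemma cvg_le_cst {u} {a : C} {M} : u @ \oo --> a -> (forall n, u n <= M) -> a <= M.
Proof. by move=> ua; apply: cvg_ler ua (cvg_cst _). Qed.

Lemma cvg_ge_cst {u} {a : C} {M} : u @ \oo --> a -> (forall n, M <= u n) -> M <= a.
Proof. by move=> ua; apply: cvg_ler ua; apply: cvg_cst. Qed.

Lemma cvg_sum (I : Type) (s : seq I) (F : I -> nat -> C) (l : I -> C) :
  (forall i, F i @ \oo --> l i) ->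
  (fun n => \sum_(i <- s) F i n) @ \oo --> \sum_(i <- s) l i.
Proof.
move=> Fl; elim: s => [|i s IH].
  by rewrite big_nil; apply: cvg_ext (cvg_cst 0) _ => n; rewrite big_nil.
by rewrite big_cons; apply: cvg_ext (cvgD (Fl i) IH) _ => n; rewrite big_cons.
Qed.

Lemma cvgn_pow {u} {l : C} k :
  u @ \oo --> l -> (fun n => u n ^+ k) @ \oo --> l ^+ k.
Proof.
move=> ul; elim: k => [|k IH].
  by rewrite [X in _ --> X]expr0; exact: (@cvg_cst C).
by rewrite exprS; apply: cvg_ext (cvgM ul IH) _ => n; rewrite exprS.
Qed.

Lemma cvgn0P u : u @ \oo --> (0 : C) <->
  forall e, 0 < e -> exists N, forall n, (N <= n)%N -> `|u n| <= e.
Proof.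
split=> [/cvgr0Pnorm_le u0 e e0|u0].
  by have [N _ hN] := u0 _ e0; exists N => n Nn; apply: hN.
apply/cvgr0Pnorm_le => e e0; have [N hN] := u0 _ e0.
by exists N => // n; apply: hN.
Qed.

Lemma cvg_conj {u} {l : C} : u @ \oo --> l -> (fun n => (u n)^*) @ \oo --> l^*.
Proof.
move=> ul; have u0 : (fun n => u n - l) @ \oo --> 0.
  by rewrite -[X in _ --> X](subrr l); apply: cvgB => //; apply: cvg_cst.
have h : (fun n => (u n)^* - l^*) @ \oo --> (0 : C).
  apply/cvgn0P => e e0; have [N hN] := (cvgn0P _).1 u0 e e0.
  by exists N => n /hN; rewrite -rmorphB norm_conjC.
rewrite -[X in _ --> X]add0r.
by apply: (cvg_ext (cvgD h (cvg_cst (l^*)))) => n; rewrite fctE subrK.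
Qed.

Lemma cvgn_bounded {u} {l : C} : u @ \oo --> l ->
  exists2 K, 0 < K & forall n, `|u n| <= K.
Proof.
move=> ul.
have /cvgn0P/(_ 1 ltr01)[N hN] : (fun n => u n - l) @ \oo --> 0.
  by rewrite -[X in _ --> X](subrr l); apply: cvgB => //; apply: cvg_cst.
exists (`|l| + 1 + \sum_(i < N) `|u i|).
  by rewrite -addrA ltr_wpDl // ltr_pwDl // sumr_ge0.
move=> n; case: (ltnP n N) => nN.
  by rewrite (bigD1 (Ordinal nN)) //= addrCA lerDl addr_ge0 ?sumr_ge0 //.
rewrite -[u n](subrK l) (le_trans (ler_normD _ _)) // addrC.
apply: (@le_trans _ _ (`|l| + 1)); first by rewrite lerD // hN.
by rewrite lerDl sumr_ge0.
Qed.
End Limits.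

Section CompleteLimits.
Variable C : numClosedFieldType.
Hypothesis hC : order_complete C.
Implicit Types (u v : nat -> C) (e q z K M : C).

Lemma monotone_cvg u M : (forall n, 0 <= u n) -> (forall n, u n <= u n.+1) ->
  (forall n, u n <= M) -> cvgn u.
Proof.
move=> u0 uS uM.
have uh n m : (n <= m)%N -> u n <= u m.
  elim: m => [|m IH]; first by rewrite leqn0 => /eqP ->.
  by rewrite leq_eqVlt => /predU1P[->//|/IH /le_trans]; apply.
have [|||s [su sl]] := @hC (range u).
- by exists (u 0%N), 0%N.
- by move=> _ [n _ <-].
- by exists M => _ [n _ <-].
apply: (cvgP s); apply/cvgrPdist_le => e e0.
have ru n : u n \is Num.real by apply: ger0_real.
have rs : s \is Num.real.
  by apply: ger0_real; apply: le_trans (u0 0%N) _; apply: su; exists 0%N.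
have [N hN] : exists N, s - e <= u N.
  apply: contrapT => /forallNP hN.
  suff : s <= s - e by rewrite lerBrDr gerDl => /le_lt_trans/(_ e0); rewrite ltxx.
  apply: sl => _ [n _ <-].
  by case/orP: (real_leVge (ru n) (rpredB rs (gtr0_real e0))) => // /hN.
exists N => // n /= Nn; rewrite ger0_norm ?subr_ge0; last by apply: su; exists n.
by rewrite lerBlDr -lerBlDl (le_trans hN) // uh.
Qed.

(** The bound M is kept explicit because sums of such series are estimated by it. *)
Definition absum (u : nat -> C) (M : C) := forall N, \sum_(0 <= k < N) `|u k| <= M.

Lemma absumW u v M : absum v M -> (forall k, `|u k| <= `|v k|) -> absum u M.
Proof. by move=> vM uv N; apply: le_trans (vM N); apply: ler_sum => k _. Qed.

Lemma cvg_series_ge0 u M : (forall k, 0 <= u k) ->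
  (forall N, \sum_(0 <= k < N) u k <= M) -> cvgn (series u).
Proof.
move=> u0 uM; apply: (@monotone_cvg _ M) => n; rewrite seriesEnat /= ?uM//.
  by apply: sumr_ge0.
by rewrite [leRHS]big_nat_recr //= lerDl.
Qed.

(* Convergence of nonnegative bounded series reaches real series by writing u as
   the difference of |u| + u and |u|. *)
Let cvg_series_real u M : (forall k, u k \is Num.real) -> absum u M ->
  cvgn (series u).
Proof.
move=> ur uM.
have h1 : cvgn (series (fun k => `|u k|)) by apply: (@cvg_series_ge0 _ M).
have h2 : cvgn (series (fun k => `|u k| + u k)).
  apply: (@cvg_series_ge0 _ (M + M)) => [k|N].
    by rewrite addrC -lerBlDl sub0r -normrN real_ler_norm ?rpredN.
  rewrite big_split /= lerD// (le_trans _ (uM N))// ler_sum// => k _.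
  exact: real_ler_norm.
have -> : u = (fun k => (`|u k| + u k) - `|u k|).
  by apply/funext => k; rewrite addrC addKr.
rewrite (seriesD (fun k => `|u k| + u k) (fun k => - `|u k|)) seriesN.
exact: is_cvgB.
Qed.

Lemma absum_cvg u M : absum u M -> cvgn (series u).
Proof.
move=> uM.
have hRe : cvgn (series (fun k => 'Re (u k))).
  apply: (@cvg_series_real _ M) => [k|]; first exact: Creal_Re.
  apply: absumW uM _ => k; exact: leif_normC_Re_Creal.
have hIm : cvgn (series (fun k => 'Im (u k))).
  apply: (@cvg_series_real _ M) => [k|]; first exact: Creal_Im.
  apply: absumW uM _ => k.
  rewrite -ler_sqr ?nnegrE// [leRHS]normC2_Re_Im real_normK ?Creal_Im//.
  by rewrite lerDr; apply: real_exprn_even_ge0; rewrite ?Creal_Re.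
have -> : u = (fun k => 'Re (u k) + 'i * 'Im (u k)).
  by apply/funext => k; rewrite -Crect.
apply: is_cvg_seriesD => //; exact: is_cvg_seriesZ.
Qed.

Lemma absum_lim u M l : absum u M -> series u @ \oo --> l -> `|l| <= M.
Proof.
move=> uM ul; apply: cvg_le_cst (cvg_norm ul) _ => n.
by apply: le_trans (uM n); rewrite seriesEnat; apply: ler_norm_sum.
Qed.

Lemma absum_geometric u K (q : C) : 0 <= q -> q < 1 ->
  (forall n, `|u n| <= K * q ^+ n) -> absum u (K / (1 - q)).
Proof.
move=> q0 q1 uK N; have q1' : 0 < 1 - q by rewrite subr_gt0.
have K0 : 0 <= K by have := uK 0%N; rewrite expr0 mulr1; apply: le_trans.
apply: le_trans (ler_sum _ (fun k _ => uK k)) _.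
rewrite -mulr_sumr ler_wpM2l// -[leRHS]mul1r ler_pdivlMr// big_mkord mulrC.
have := subrX1 q N; rewrite -opprB -[q - 1]opprB mulNr => /oppr_inj <-.
by rewrite gerBl exprn_ge0.
Qed.

Lemma cvg_exprn0 (z : C) : `|z| < 1 -> (fun n => z ^+ n) @ \oo --> (0 : C).
Proof.
move=> z1; apply: cvg_series_cvg_0.
apply: (@absum_cvg _ (1 / (1 - `|z|))); apply: absum_geometric => // n.
by rewrite mul1r normrX.
Qed.

Lemma absum_tail v M e : absum v M -> 0 < e ->
  exists N, forall n, \sum_(N <= k < n) `|v k| <= e.
Proof.
move=> vM e0; have /cvg_ex[s vs] := cvg_series_ge0 (fun k => normr_ge0 (v k)) vM.
have vs0 : (fun n => series (fun k => `|v k|) n - s) @ \oo --> 0.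
  by rewrite -[X in _ --> X](subrr s); apply: cvgB => //; apply: cvg_cst.
have [N hN] := (cvgn0P _).1 vs0 _ e0; exists N => n.
have [nN|Nn] := ltnP n N; first by rewrite big_geq ?(ltW e0)// ltnW.
apply: le_trans (hN N (leqnn N)); rewrite distrC.
have hs m : series (fun k => `|v k|) m <= s.
  pose S := series (fun k => `|v k|); apply: (cvg_ge_cst (u := fun i => S (i + m)%N)).
    by rewrite (cvg_shiftn m).
  move=> i; rewrite !seriesEnat /= [leRHS](@big_cat_nat _ _ _ m) ?leq_addl//=.
  by rewrite lerDl sumr_ge0.
rewrite ger0_norm ?subr_ge0// lerBrDl; apply: le_trans (hs n).
by rewrite !seriesEnat /= [leRHS](@big_cat_nat _ _ _ N).
Qed.

(** For large n, either the index of u or that of v is large: the first terms are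
    small because u is, the last ones because the tail of v is. *)
Lemma conv_null u v K : u @ \oo --> (0 : C) -> absum v K ->
  (fun n => \sum_(j < n.+1) u (n - j)%N * v j) @ \oo --> (0 : C).
Proof.
move=> u0 vK; have [B B0 uB] := cvgn_bounded u0.
have K0 : 0 <= K by have := vK 0%N; rewrite big_geq.
have K1 : 0 < K + 1 by rewrite ltr_wpDl.
apply/cvgn0P => e e0; have e2 : 0 < e / 2 by rewrite divr_gt0.
have [N1 hN1] := (cvgn0P u).1 u0 _ (divr_gt0 e2 K1).
have [N2 hN2] := absum_tail vK (divr_gt0 e2 B0).
exists (N1 + N2)%N => n nN.
rewrite -(big_mkord xpredT (fun j => u (n - j)%N * v j)).
have N2n : (N2 <= n.+1)%N by rewrite (leq_trans (leq_addl N1 _))// ltnW.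
rewrite (@big_cat_nat _ _ _ N2)//= (le_trans (ler_normD _ _))//.
rewrite [leRHS](splitr e) lerD//.
  apply: le_trans (ler_norm_sum _ _ _) _.
  apply: (@le_trans _ _ (\sum_(0 <= j < N2) (e / 2 / (K + 1)) * `|v j|)).
    rewrite big_nat [leRHS]big_nat; apply: ler_sum => j /andP[_ jN].
    rewrite normrM ler_wpM2r// hN1// leq_subRL.
      by rewrite addnC (leq_trans _ nN)// leq_add2l ltnW.
    by rewrite (leq_trans (ltnW jN))// (leq_trans _ nN)// leq_addl.
  rewrite -mulr_sumr -mulrA ler_piMr ?(ltW e2)// mulrC.
  by rewrite ler_pdivrMr// mul1r (le_trans (vK _))// lerDl.
apply: le_trans (ler_norm_sum _ _ _) _.
apply: (@le_trans _ _ (\sum_(N2 <= j < n.+1) B * `|v j|)).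
  by apply: ler_sum => j _; rewrite normrM ler_wpM2r.
by rewrite -mulr_sumr mulrC -ler_pdivlMr.
Qed.

(** Mertens' theorem.  The N-th partial sum of the convolution is the sum of
    U_(N-j) v_j, where U_n are the partial sums of u; its distance to a times the
    partial sum of v is the convolution of the null sequence a - U_n with v. *)
Lemma cvg_series_conv u v K (a b : C) :
  series u @ \oo --> a -> series v @ \oo --> b -> absum v K ->
  series (fun n => \sum_(j < n.+1) u (n - j)%N * v j) @ \oo --> a * b.
Proof.
move=> ua vb vK.
have sumE n : series (fun n => \sum_(j < n.+1) u (n - j)%N * v j) n =
    \sum_(j < n) series u (n - j)%N * v j.
  elim: n => [|n IH]; first by rewrite seriesEnat /= big_geq// big_ord0.
  have S1 : series u 1%N = u 0%N by rewrite seriesEnat /= big_nat1.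
  rewrite seriesSr IH !big_ord_recr /= subSnn subnn S1.
  rewrite addrA; congr (_ + _); rewrite -big_split /=.
  apply: eq_bigr => j _; rewrite subSn; last by rewrite ltnW.
  by rewrite seriesSr mulrDl.
pose w n := a * series v n.+1 -
            \sum_(j < n.+1) (a - series u (n - j).+1) * v j.
have wE : w = [sequence series (fun n => \sum_(j < n.+1) u (n - j)%N * v j) n.+1]_n.
  apply/funext => n /=; rewrite sumE /w seriesEord /= mulr_sumr -sumrB.
  apply: eq_bigr => j _; rewrite -mulrBl subKr subSn//.
  by rewrite -ltnS.
suff : w @ \oo --> a * b by rewrite wE cvg_shiftS.
rewrite -[X in _ --> X]subr0; apply: cvgB.
  by apply: cvgMl_tmp; rewrite (cvg_shiftS (series v)).
apply: (conv_null (u := fun n => a - series u n.+1) _ vK).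
rewrite -[X in _ --> X](subrr a); apply: cvgB; first exact: cvg_cst.
by rewrite (cvg_shiftS (series u)).
Qed.
End CompleteLimits.

(** * Power series on the disc *)

Section Taylor.
Variable C : numClosedFieldType.
Hypothesis hC : order_complete C.
Implicit Types (f g : C -> C) (a b : nat -> C) (z r l M K : C).

Lemma cvg_bounded_power a r l :
  series (fun n => a n * r ^+ n) @ \oo --> l -> 0 < r ->
  exists2 K, 0 < K & forall n, `|a n| <= K * r ^- n.
Proof.
move=> al r0.
have /cvgn_bounded[K K0 hK] := cvg_series_cvg_0 (cvgP _ al).
exists K => // n; have := hK n.
by rewrite normrM normrX (gtr0_norm r0) -ler_pdivlMr ?exprn_gt0.
Qed.

Lemma taylor_absum f a z : has_taylor f a -> `|z| < 1 ->
  exists M, absum (fun n => a n * z ^+ n) M.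
Proof.
(* r lies between |z| and 1: the terms are bounded at r, so they decay
   geometrically at z. *)
move=> fa z1; pose r := (1 + `|z|) / 2.
have zr : `|z| < r by rewrite ltr_pdivlMr// mulr_natr mulr2n ltrD2r.
have r0 : 0 < r by apply: le_lt_trans zr.
have r1 : `|r| < 1 by rewrite gtr0_norm// ltr_pdivrMr// mul1r ltrD2l.
have [K K0 hK] := cvg_bounded_power (fa _ r1) r0.
exists (K / (1 - `|z| / r)); apply: absum_geometric => [||n].
- by rewrite divr_ge0// ltW.
- by rewrite ltr_pdivrMr// mul1r.
by rewrite normrM normrX expr_div_n mulrA mulrAC ler_wpM2r.
Qed.

(* The bound |a_n| <= K 2^n at radius 1/2 turns the vanishing of the sum at t > 0
   into |a_0| <= 2tK / (1 - 2t), which fails for t = |a_0| / (8K). *)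
Let power_series_fst0 a :
  (forall z, 0 < `|z| < 1 -> series (fun n => a n * z ^+ n) @ \oo --> (0 : C)) ->
  a 0%N = 0.
Proof.
move=> a0; apply: contrapT => /eqP an0.
have h0 : 0 < 2^-1 :> C by rewrite invr_gt0.
have h1 : 0 < `|2^-1 : C| < 1.
  by rewrite gtr0_norm// h0 invf_lt1 ?ltr1n.
have [K K0 hK] := cvg_bounded_power (a0 _ h1) h0.
pose t := `|a 0%N| / (8 * K).
have t0 : 0 < t by rewrite divr_gt0 ?mulr_gt0 ?normr_gt0.
have tE : `|a 0%N| = K * (t * 8) by rewrite /t; field; rewrite gt_eqF.
have t8 : t * 8 <= 1.
  rewrite -(ler_pM2l K0) mulr1 -tE.
  by have := hK 0%N; rewrite expr0 invr1 mulr1.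
clearbody t.
have t1 : 0 < `|t| < 1.
  rewrite gtr0_norm// t0 /=; apply: lt_le_trans t8.
  by rewrite ltr_pMr// ltr1n.
have t2 : t * 2 <= 2^-1.
  rewrite -[leRHS]mul1r ler_pdivlMr// -mulrA -natrM.
  by apply: le_trans t8; rewrite ler_pM2l// ler_nat.
pose v k := a k.+1 * t ^+ k.+1.
have vM : absum v (K * (t * 2) / (1 - t * 2)).
  apply: absum_geometric => [||n]; first by rewrite mulr_ge0 ?ltW.
    by apply: le_lt_trans t2 _; rewrite invf_lt1 ?ltr1n.
  rewrite -mulrA -exprS /v normrM normrX (gtr0_norm t0) exprMn mulrA mulrAC.
  rewrite ler_wpM2r ?exprn_ge0 ?(ltW t0)//.
  by apply: le_trans (hK _) _; rewrite exprVn invrK.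
have va : series v @ \oo --> - a 0%N.
  have -> : series v = (fun n => series (fun n => a n * t ^+ n) n.+1 - a 0%N).
    apply/funext => n; rewrite !seriesEnat /= [X in _ = X - _]big_nat_recl//=.
    by rewrite expr0 mulr1 addrC addKr.
  rewrite -[X in _ --> X]sub0r; apply: cvgB; last exact: cvg_cst.
  by have := a0 _ t1; rewrite -cvg_shiftS.
have := absum_lim vM va; rewrite normrN.
rewrite tE => /(@le_trans _ _ _ _ (K * (t * 4))).
have t2' : 0 < 1 - t * 2.
  by rewrite subr_gt0; apply: le_lt_trans t2 _; rewrite invf_lt1 ?ltr1n.
have -> : K * (t * 2) / (1 - t * 2) <= K * (t * 4).
  rewrite ler_pdivrMr// -mulrA ler_pM2l// -mulrA ler_pM2l//.
  have -> : 4 * (1 - t * 2) = 4 - t * 8 by ring.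
  rewrite lerBrDr; apply: (@le_trans _ _ (2 + 1)); first by rewrite lerD2l.
  by rewrite -[1]/(1%:R) -natrD ler_nat.
by move=> /(_ isT); rewrite ler_pM2l// ler_pM2l// ler_nat.
Qed.

(** Once a_0 = 0, the series can be divided by z; hence the point 0 is excluded
    from the hypothesis. *)
Lemma power_series_eq0 a :
  (forall z, 0 < `|z| < 1 -> series (fun n => a n * z ^+ n) @ \oo --> (0 : C)) ->
  forall n, a n = 0.
Proof.
move=> + n; elim: n a => [|n IH] a a0; first exact: power_series_fst0.
apply: (IH (fun k => a k.+1)) => z z01.
have zn0 : z != 0 by rewrite -normr_gt0; case/andP: z01.
have -> : series (fun k => a k.+1 * z ^+ k) =
          (fun n => z^-1 * series (fun n => a n * z ^+ n) n.+1).
  apply/funext => m; rewrite !seriesEnat /= [X in _ = _ * X]big_nat_recl//=.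
  rewrite (power_series_fst0 a0) mul0r add0r mulr_sumr; apply: eq_bigr => k _.
  by rewrite exprS mulrCA mulKf.
rewrite -[X in _ --> X](mulr0 z^-1); apply: cvgMl_tmp.
by have := a0 _ z01; rewrite -cvg_shiftS.
Qed.

Lemma has_taylor_ext f g a b : has_taylor f a ->
  (forall z, `|z| < 1 -> f z = g z) -> (forall n, a n = b n) -> has_taylor g b.
Proof.
move=> fa fg ab z z1; rewrite -fg//.
by have <- : a = b; [apply/funext | apply: fa].
Qed.

Lemma has_taylorB f g a b : has_taylor f a -> has_taylor g b ->
  has_taylor (fun z => f z - g z) (fun n => a n - b n).
Proof.
move=> fa gb z z1; apply: (cvg_ext (cvgB (fa _ z1) (gb _ z1))) => n /=.
rewrite !fctE !seriesEnat /= -sumrB.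
by apply: eq_bigr => k _; rewrite mulrBl.
Qed.

Lemma taylor_unique f a b : has_taylor f a -> has_taylor f b -> a = b.
Proof.
move=> fa fb; apply/funext => n; apply/eqP; rewrite -subr_eq0; apply/eqP.
apply: (@power_series_eq0 (fun n => a n - b n)) => z /andP[_ z1].
by rewrite -[X in _ --> X](subrr (f z)); apply: (has_taylorB fa fb).
Qed.

Lemma taylorE f a : has_taylor f a -> taylor f = a.
Proof.
move=> fa; apply: taylor_unique (fa).
by apply: (@xgetPex _ _ [set a | has_taylor f a]); exists a.
Qed.

Lemma has_taylor_taylor f : analytic f -> has_taylor f (taylor f).
Proof. by move=> [a fa]; rewrite (taylorE fa). Qed.

Lemma has_taylor0 : has_taylor (fun=> 0) (fun=> 0 : C).
Proof.
move=> z z1.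
have -> : series (fun n => 0 * z ^+ n) = (fun=> 0); last exact: cvg_cst.
by apply/funext => n; rewrite seriesEnat /= big1// => k _; rewrite mul0r.
Qed.

Lemma has_taylorD f g a b : has_taylor f a -> has_taylor g b ->
  has_taylor (fun z => f z + g z) (fun n => a n + b n).
Proof.
move=> fa gb z z1; apply: (cvg_ext (cvgD (fa _ z1) (gb _ z1))) => n /=.
rewrite !fctE !seriesEnat /= -big_split.
by apply: eq_bigr => k _ /=; rewrite mulrDl.
Qed.

Lemma has_taylor_sum (I : Type) (s : seq I) (F : I -> C -> C) (A : I -> nat -> C) :
  (forall i, has_taylor (F i) (A i)) ->
  has_taylor (fun z => \sum_(i <- s) F i z) (fun n => \sum_(i <- s) A i n).
Proof.
move=> FA; elim: s => [|i s IH].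
  by apply: has_taylor_ext has_taylor0 _ _ => *; rewrite big_nil.
by apply: has_taylor_ext (has_taylorD (FA i) IH) _ _ => *; rewrite big_cons.
Qed.

Lemma has_taylorM f g a b : has_taylor f a -> has_taylor g b ->
  has_taylor (fun z => f z * g z) (fun n => \sum_(j < n.+1) a (n - j)%N * b j).
Proof.
move=> fa gb z z1; have [K gK] := taylor_absum gb z1.
apply: (cvg_ext (cvg_series_conv hC (fa _ z1) (gb _ z1) gK)) => N.
rewrite !seriesEnat /=; apply: eq_bigr => n _.
rewrite mulr_suml; apply: eq_bigr => j _.
by rewrite mulrACA -exprD subnK// -ltnS.
Qed.

(** ** Bounded analytic functions are square summable *)

Lemma prim_root_pow2 j : exists w : C, (2 ^ j.+1).-primitive_root w.
Proof.
have [w wN1] : exists w : C, w ^+ (2 ^ j) = -1.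
  elim: j => [|j [w wN1]]; first by exists (-1); rewrite expn0 expr1.
  by exists (sqrtC w); rewrite expnS exprM sqrtCK.
have w1 : w ^+ (2 ^ j.+1) = 1 by rewrite expnSr exprM wN1 sqrrN expr1n.
have [d pd dj] := prim_order_exists (expn_gt0 2 j.+1) w1; exists w.
have /(dvdn_pfactor _ _ (isT : prime 2))[l + dE] := dj.
rewrite dE leq_eqVlt ltnS in pd * => /predU1P[<- //|lj].
have : w ^+ (2 ^ j) = 1.
  by apply/eqP; rewrite -(prim_order_dvd pd) dvdn_exp2l.
by rewrite wN1 => /eqP; rewrite eqNr oner_eq0.
Qed.

(** Parseval's identity for a polynomial of degree less than N, with the mean over
    the N-th roots of unity in place of an integral over the circle. *)
Lemma discrete_parseval N (w : C) (c : 'I_N -> C) : N.-primitive_root w ->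
  \sum_(j < N) `|\sum_(n < N) c n * w ^+ (j * n)| ^+ 2 =
  N%:R * \sum_(n < N) `|c n| ^+ 2.
Proof.
move=> pw; have N0 := prim_order_gt0 pw; have wN := prim_expr_order pw.
have w1 : `|w| = 1.
  by apply/eqP; rewrite -(@pexpr_eq1 _ _ N)// -normrX wN normr1.
have wn0 : w != 0 by rewrite -normr_gt0 w1.
have wc : w^* = w^-1 by rewrite [RHS]invC_norm w1 expr1n invr1 mul1r.
transitivity (\sum_(j < N) \sum_(n < N) \sum_(m < N)
    c n * (c m)^* * (w ^+ n / w ^+ m) ^+ j).
  apply: eq_bigr => j _; rewrite normCK rmorph_sum mulr_suml; apply: eq_bigr => n _.
  rewrite mulr_sumr; apply: eq_bigr => m _.
  rewrite rmorphM rmorphXn /= wc mulrACA exprMn -!exprVn -!exprM.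
  by rewrite ![(j * _)%N]mulnC.
rewrite exchange_big mulr_sumr; apply: eq_bigr => n _.
rewrite exchange_big (bigD1 n)//= [X in _ + X]big1 ?addr0 => [|m mn].
  rewrite divff ?expf_neq0//; under eq_bigr do rewrite expr1n mulr1.
  by rewrite -normCK sumr_const card_ord mulr_natl.
rewrite -mulr_sumr; set q := w ^+ n / w ^+ m.
have q1 : q != 1.
  rewrite /q; apply/eqP => /divr1_eq/eqP.
  rewrite (eq_prim_root_expr pw) !modn_small//.
  by rewrite eq_sym (inj_eq val_inj) (negPf mn).
have : (q - 1) * (\sum_(j < N) q ^+ j) = 0.
  rewrite -subrX1 /q expr_div_n -!exprM ![(_ * N)%N]mulnC !exprM.
  by rewrite wN !expr1n divr1 subrr.
move/eqP; rewrite mulf_eq0 subr_eq0 (negPf q1) /= => /eqP ->.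
by rewrite mulr0.
Qed.

(** On the circle of radius r < 1, the Taylor polynomial of large degree N is within
    1 of f, so the mean of its square over the N-th roots of unity is at most
    (M + 1)^2; then r tends to 1. *)
Lemma Hinf_square_summable f : Hinf f ->
  exists B, forall N, \sum_(n < N) `|taylor f n| ^+ 2 <= B.
Proof.
move=> [/has_taylor_taylor fa [M fM]]; set a := taylor f in fa *.
have M0 : 0 <= M by apply: le_trans (fM 0 _); rewrite ?normr0.
exists ((M + 1) ^+ 2) => K.
have hr r : 0 <= r < 1 -> \sum_(n < K) `|a n * r ^+ n| ^+ 2 <= (M + 1) ^+ 2.
  move=> /andP[r0 r1]; have nr : `|r| < 1 by rewrite ger0_norm.
  have [A aA] := taylor_absum fa nr.
  have [N0 hN0] := absum_tail hC aA ltr01.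
  pose N := (2 ^ (maxn K N0).+1)%N; have [w pw] := prim_root_pow2 (maxn K N0).
  have ltN : (maxn K N0 < N)%N by rewrite (leq_ltn_trans (leqnSn _))// ltn_expl.
  have N_gt0 : (0 < N)%N by rewrite expn_gt0.
  have w1 : `|w| = 1.
    by apply/eqP; rewrite -(@pexpr_eq1 _ _ N)// -normrX (prim_expr_order pw) normr1.
  apply: (@le_trans _ _ (\sum_(n < N) `|a n * r ^+ n| ^+ 2)).
    rewrite -[leLHS](big_mkord xpredT (fun n => `|a n * r ^+ n| ^+ 2)).
    rewrite -[leRHS](big_mkord xpredT (fun n => `|a n * r ^+ n| ^+ 2)).
    have KN : (K <= N)%N by rewrite (leq_trans (leq_maxl K N0))// ltnW.
    by rewrite [leRHS](@big_cat_nat _ _ _ K)//= lerDl sumr_ge0.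
  have NR : 0 < N%:R :> C by rewrite ltr0n.
  rewrite -(ler_pM2l NR) -(discrete_parseval (fun n => a n * r ^+ n) pw).
  have -> : N%:R * (M + 1) ^+ 2 = \sum_(j < N) (M + 1) ^+ 2.
    by rewrite sumr_const card_ord mulr_natl.
  apply: ler_sum => j _; rewrite ler_sqr ?nnegrE ?addr_ge0//.
  have z1 : `|r * w ^+ j| < 1 by rewrite normrM normrX w1 expr1n mulr1.
  have SE n : series (fun n => a n * (r * w ^+ j) ^+ n) n =
      \sum_(0 <= n < n) a n * r ^+ n * w ^+ (j * n).
    by rewrite seriesEnat; apply: eq_bigr => k _; rewrite exprMn exprM mulrA.
  have hd : `|f (r * w ^+ j) - series (fun n => a n * (r * w ^+ j) ^+ n) N| <= 1.
    have := fa _ z1; rewrite -(cvg_shiftn N).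
    move=> /cvgB/(_ (cvg_cst (series (fun n => a n * (r * w ^+ j) ^+ n) N))).
    move=> /cvg_norm/cvg_le_cst; apply => n /=.
    rewrite fctE /= series_addn [X in `|X|]addrC addKr.
    apply: le_trans (ler_norm_sum _ _ _) _; apply: le_trans (hN0 (n + N)%N).
    rewrite [leRHS](@big_cat_nat _ _ _ N) ?leq_addl//=; last first.
      by rewrite (leq_trans (leq_maxr K N0))// ltnW.
    rewrite -[leLHS]add0r lerD ?sumr_ge0//; apply: ler_sum => k _.
    by rewrite exprMn mulrA normrM !normrX w1 !expr1n mulr1.
  rewrite -(big_mkord xpredT (fun n => a n * r ^+ n * w ^+ (j * n))) -SE.
  rewrite -[X in `|X|](subKr (f (r * w ^+ j))) (le_trans (ler_normB _ _))//.
  by rewrite lerD// fM.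
pose rho (m : nat) : C := 1 - 2^-1 ^+ m.
have rho01 m : 0 <= rho m < 1.
  rewrite /rho subr_ge0 ltrBlDr ltrDl exprn_gt0// andbT.
  by rewrite exprn_ile1// invf_le1// ler1n.
apply: (cvg_le_cst (u := fun m => \sum_(n < K) `|a n * rho m ^+ n| ^+ 2)) => // [|m];
  last exact: hr.
apply: cvg_sum => n; apply: cvgn_pow; apply: cvg_norm.
rewrite -[X in _ --> X]mulr1; apply: cvgMl_tmp.
rewrite -[X in _ --> X](expr1n _ n); apply: cvgn_pow.
rewrite -[X in _ --> X](subr0 1); apply: cvgB; first exact: cvg_cst.
by apply: (cvg_exprn0 hC); rewrite gtr0_norm ?invr_gt0// invf_lt1// ltr1n.
Qed.
End Taylor.

(** * The Hilbert space of square summable sequences *)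

(* Unqualified, [shift] denotes a translation. *)
Notation fshift := Defs.shift.

Definition coshift {C : numClosedFieldType} {n : nat} (x : nat -> 'cV[C]_n) :
  nat -> 'cV[C]_n := fun k => x k.+1.

Section Vdot.
Local Open Scope sesquilinear_scope.
Variable C : numClosedFieldType.

Lemma vdotE n (u v : 'cV[C]_n) : vdot u v = \sum_i u i ord0 * (v i ord0)^*.
Proof. by rewrite /vdot mxE; apply: eq_bigr => i _; rewrite !mxE mulrC. Qed.

Lemma vdotDl n (u u' v : 'cV[C]_n) : vdot (u + u') v = vdot u v + vdot u' v.
Proof. by rewrite /vdot mulmxDr mxE. Qed.

Lemma vdotZl n a (u v : 'cV[C]_n) : vdot (a *: u) v = a * vdot u v.
Proof. by rewrite /vdot -scalemxAr mxE. Qed.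

Lemma vdotC n (u v : 'cV[C]_n) : vdot v u = (vdot u v)^*.
Proof.
rewrite !vdotE rmorph_sum; apply: eq_bigr => i _.
by rewrite rmorphM /= conjCK mulrC.
Qed.

Lemma vdotDr n (u v v' : 'cV[C]_n) : vdot u (v + v') = vdot u v + vdot u v'.
Proof. by rewrite vdotC vdotDl rmorphD /= -!vdotC. Qed.

Lemma vdotZr n a (u v : 'cV[C]_n) : vdot u (a *: v) = a^* * vdot u v.
Proof. by rewrite vdotC vdotZl rmorphM /= -vdotC. Qed.

Lemma vdot0l n (v : 'cV[C]_n) : vdot 0 v = 0.
Proof. by rewrite -(scale0r 0) vdotZl mul0r. Qed.

Lemma vdot_sqE n (u : 'cV[C]_n) : vdot u u = \sum_i `|u i ord0| ^+ 2.
Proof. by rewrite vdotE; apply: eq_bigr => i _; rewrite normCK. Qed.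

Lemma vdot_ge0 n (u : 'cV[C]_n) : 0 <= vdot u u.
Proof. by rewrite vdot_sqE sumr_ge0// => i _; rewrite exprn_ge0. Qed.

Lemma vdot_entry_le n (u : 'cV[C]_n) i : `|u i ord0| ^+ 2 <= vdot u u.
Proof.
by rewrite vdot_sqE (bigD1 i)//= lerDl sumr_ge0// => j _; rewrite exprn_ge0.
Qed.

Lemma vdot_eq0 n (u : 'cV[C]_n) : vdot u u = 0 -> u = 0.
Proof.
move=> u0; apply/colP => i; rewrite mxE; apply/eqP.
have := vdot_entry_le u i; rewrite u0 => h.
by rewrite -normr_eq0 -sqrf_eq0 eq_le h exprn_ge0.
Qed.

Lemma vdot_ext n (u v : 'cV[C]_n) : (forall w, vdot w u = vdot w v) -> u = v.
Proof.
move=> uv; apply/eqP; rewrite -subr_eq0; apply/eqP/vdot_eq0.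
by rewrite vdotDr -scaleN1r vdotZr uv rmorphN rmorph1 mulN1r subrr.
Qed.

Lemma vdot_adj r s (A : 'M[C]_(r, s)) (u : 'cV_s) (v : 'cV_r) :
  vdot (A *m u) v = vdot u (A ^t* *m v).
Proof.
rewrite /vdot mulmxA trmx_mul map_mxM /=; congr ((_ *m _ *m _) _ _).
by apply/matrixP => i j; rewrite !mxE conjCK.
Qed.

(** A weak form of the Cauchy-Schwarz inequality, enough for the convergence of
    inner products. *)
Lemma vdot_le_mean n (u v : 'cV[C]_n) : `|vdot u v| <= vdot u u + vdot v v.
Proof.
rewrite !vdot_sqE vdotE -big_split; apply: le_trans (ler_norm_sum _ _ _) _.
apply: ler_sum => i _ /=; rewrite normrM norm_conjC.
move: (normr_ge0 (u i ord0)) (normr_ge0 (v i ord0)).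
move: `|u i ord0| `|v i ord0| => a b a0 b0.
rewrite -subr_ge0; have -> : a ^+ 2 + b ^+ 2 - a * b = (a - b) ^+ 2 + a * b by ring.
apply: addr_ge0; last exact: mulr_ge0.
by apply: real_exprn_even_ge0 => //; apply: rpredB; apply: ger0_real.
Qed.
End Vdot.

Section L2.
Variable C : numClosedFieldType.
Hypothesis hC : order_complete C.
Variable n : nat.
Implicit Types (x y z : nat -> 'cV[C]_n) (a c M : C) (u v : 'cV[C]_n).

Lemma l2_bounded x M : (forall N, \sum_(k < N) vdot (x k) (x k) <= M) -> l2 x.
Proof.
move=> xM; apply: (cvg_series_ge0 hC (M := M)) => [k|N]; first exact: vdot_ge0.
by rewrite big_mkord.
Qed.

Lemma l2dot_le x M : (forall N, \sum_(k < N) vdot (x k) (x k) <= M) ->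
  l2dot x x <= M.
Proof.
move=> xM; apply: (cvg_le_cst (l2_bounded xM)) => N.
by rewrite seriesEord; apply: xM.
Qed.

Lemma l2_partial x N : l2 x -> \sum_(k < N) vdot (x k) (x k) <= l2dot x x.
Proof.
move=> lx; pose s := series (fun k => vdot (x k) (x k)).
have h : (fun i => s (i + N)%N) @ \oo --> l2dot x x.
  by rewrite (cvg_shiftn N s); exact: lx.
apply: (cvg_ge_cst h) => i.
rewrite /s series_addn seriesEord /= lerDl sumr_ge0// => k _.
exact: vdot_ge0.
Qed.

Lemma cvg_l2dot x y : l2 x -> l2 y ->
  series (fun k => vdot (x k) (y k)) @ \oo --> l2dot x y.
Proof.
move=> lx ly; apply: (absum_cvg hC (M := l2dot x x + l2dot y y)) => N.
apply: le_trans (lerD (l2_partial N lx) (l2_partial N ly)).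
rewrite -big_split big_mkord; apply: ler_sum => k _; exact: vdot_le_mean.
Qed.

Lemma l2dot_ge0 x : l2 x -> 0 <= l2dot x x.
Proof. by move=> lx; have := l2_partial 0 lx; rewrite big_ord0. Qed.

Lemma l2_entry_le x k : l2 x -> vdot (x k) (x k) <= l2dot x x.
Proof.
move=> lx; apply: le_trans (l2_partial k.+1 lx).
by rewrite big_ord_recr /= lerDr sumr_ge0// => j _; apply: vdot_ge0.
Qed.

Lemma l2dot_eq0 x : l2 x -> l2dot x x = 0 -> x = 0.
Proof.
move=> lx x0; apply/funext => k; apply/vdot_eq0/eqP.
by rewrite eq_le vdot_ge0 andbT -x0 l2_entry_le.
Qed.

Lemma l2D x y : l2 x -> l2 y -> l2 (x + y).
Proof.
move=> lx ly; apply: (@l2_bounded _ (2 * (l2dot x x + l2dot y y))) => N.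
apply: le_trans (ler_wpM2l _ (lerD (l2_partial N lx) (l2_partial N ly))) => //.
rewrite -big_split mulr_sumr; apply: ler_sum => k _ /=.
rewrite -subr_ge0; apply: le_trans (vdot_ge0 (x k - y k)) _.
rewrite le_eqVlt; apply/orP; left; apply/eqP.
rewrite fctE -scaleN1r !(vdotDl, vdotDr, vdotZl, vdotZr) rmorphN rmorph1.
by ring.
Qed.

Lemma l2Z a x : l2 x -> l2 (a *: x).
Proof.
move=> lx; apply: (@l2_bounded _ (`|a| ^+ 2 * l2dot x x)) => N.
apply: le_trans (ler_wpM2l _ (l2_partial N lx)); rewrite ?exprn_ge0//.
rewrite mulr_sumr; apply: ler_sum => k _ /=.
by rewrite fctE vdotZl vdotZr mulrA normCK.
Qed.

Lemma l20 : l2 (0 : nat -> 'cV[C]_n).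
Proof. by apply: (@l2_bounded _ 0) => N; rewrite big1// => k _; rewrite vdot0l. Qed.

Lemma l2N x : l2 x -> l2 (- x).
Proof. by rewrite -scaleN1r; apply: l2Z. Qed.

Lemma l2B x y : l2 x -> l2 y -> l2 (x - y).
Proof. by move=> lx ly; apply: l2D => //; apply: l2N. Qed.

Lemma l2dotDl x y z : l2 x -> l2 y -> l2 z ->
  l2dot (x + y) z = l2dot x z + l2dot y z.
Proof.
move=> lx ly lz; apply: (cvgn_unique (cvg_l2dot (l2D lx ly) lz)).
apply: cvg_ext (cvgD (cvg_l2dot lx lz) (cvg_l2dot ly lz)) _ => N.
rewrite fctE !seriesEnat /= -big_split; apply: eq_bigr => k _.
exact/esym/vdotDl.
Qed.

Lemma l2dotZl a x y : l2 x -> l2 y -> l2dot (a *: x) y = a * l2dot x y.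
Proof.
move=> lx ly; apply: (cvgn_unique (cvg_l2dot (l2Z lx) ly)).
apply: cvg_ext (cvgMl_tmp (cvg_l2dot lx ly)) _ => N.
rewrite !seriesEnat /= mulr_sumr; apply: eq_bigr => k _.
exact/esym/vdotZl.
Qed.

Lemma l2dotC x y : l2 x -> l2 y -> l2dot y x = (l2dot x y)^*.
Proof.
move=> lx ly; apply: (cvgn_unique (cvg_l2dot ly lx)).
apply: cvg_ext (cvg_conj (cvg_l2dot lx ly)) _ => N.
rewrite !seriesEnat /= rmorph_sum; apply: eq_bigr => k _.
exact/esym/vdotC.
Qed.

Lemma l2dotDr x y z : l2 x -> l2 y -> l2 z ->
  l2dot z (x + y) = l2dot z x + l2dot z y.
Proof.
move=> lx ly lz; rewrite l2dotC ?l2dotDl//; last exact: l2D.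
by rewrite rmorphD /= -!l2dotC.
Qed.

Lemma l2dotZr a x y : l2 x -> l2 y -> l2dot x (a *: y) = a^* * l2dot x y.
Proof.
move=> lx ly; rewrite l2dotC ?l2dotZl//; last exact: l2Z.
by rewrite rmorphM /= -l2dotC.
Qed.

Lemma l2dot0l y : l2 y -> l2dot 0 y = 0.
Proof. by move=> ly; rewrite -(scale0r 0) l2dotZl ?mul0r//; apply: l20. Qed.

Lemma l2dot0r y : l2 y -> l2dot y 0 = 0.
Proof. by move=> ly; rewrite l2dotC ?l2dot0l ?conjC0//; apply: l20. Qed.

Lemma l2dotBl x y z : l2 x -> l2 y -> l2 z ->
  l2dot (x - y) z = l2dot x z - l2dot y z.
Proof.
move=> lx ly lz; rewrite -scaleN1r l2dotDl// ?l2dotZl ?mulN1r//; exact: l2Z.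
Qed.

Lemma l2dotBr x y z : l2 x -> l2 y -> l2 z ->
  l2dot z (x - y) = l2dot z x - l2dot z y.
Proof.
move=> lx ly lz; rewrite -scaleN1r l2dotDr// ?l2dotZr ?rmorphN ?rmorph1 ?mulN1r//.
exact: l2Z.
Qed.

Lemma l2_cauchy_schwarz x y : l2 x -> l2 y ->
  `|l2dot x y| ^+ 2 <= l2dot x x * l2dot y y.
Proof.
move=> lx ly; have x0 := l2dot_ge0 lx; have y0 := l2dot_ge0 ly.
have [yy0|yn0] := eqVneq (l2dot y y) 0.
  by rewrite (l2dot_eq0 ly yy0) !l2dot0r ?normr0 ?expr0n ?mulr0//; apply: l20.
have yp : 0 < l2dot y y by rewrite lt_neqAle eq_sym yn0.
set c := l2dot x y.
have lX : l2 (l2dot y y *: x) by apply: l2Z.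
have lY : l2 (c *: y) by apply: l2Z.
have lw := l2B lX lY; have := l2dot_ge0 lw.
rewrite (l2dotBl lX lY lw) (l2dotBr lX lY lX) (l2dotBr lX lY lY).
rewrite (l2dotZl _ lx lX) (l2dotZl _ lx lY) (l2dotZl _ ly lX) (l2dotZl _ ly lY).
rewrite (l2dotZr _ lx lx) (l2dotZr _ lx ly) (l2dotZr _ ly lx) (l2dotZr _ ly ly).
rewrite (l2dotC lx ly) -/c (conj_Creal (ger0_real y0)).
have -> : l2dot y y * (l2dot y y * l2dot x x) - l2dot y y * (c^* * c) -
    (c * (l2dot y y * c^*) - c * (c^* * l2dot y y)) =
    l2dot y y * (l2dot x x * l2dot y y - c * c^*) by ring.
rewrite -normCK.
by rewrite pmulr_rge0// subr_ge0.
Qed.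

(** ** Shifts and monomials *)

Lemma l2dot_cons x y : l2 x -> l2 y ->
  l2 (coshift x) ->  l2 (coshift y) ->
  l2dot x y = vdot (x 0%N) (y 0%N) + l2dot (coshift x) (coshift y).
Proof.
move=> lx ly lx' ly'; have := cvg_l2dot lx ly; rewrite -cvg_shiftS => h.
apply: (cvgn_unique h).
apply: cvg_ext (cvgD (cvg_cst (vdot (x 0%N) (y 0%N))) (cvg_l2dot lx' ly')) _ => N.
by rewrite fctE !seriesEnat /= big_nat_recl.
Qed.

Lemma l2_coshift x : l2 x -> l2 (coshift x).
Proof.
move=> lx; apply: (@l2_bounded _ (l2dot x x)) => N.
apply: le_trans (l2_partial N.+1 lx); rewrite big_ord_recl /= lerDr.
exact: vdot_ge0.
Qed.

Lemma l2_shift x : l2 x -> l2 (fshift x).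
Proof.
move=> lx; apply: (@l2_bounded _ (l2dot x x)) => -[|N].
  by rewrite big_ord0; apply: l2dot_ge0.
rewrite big_ord_recl /= vdot0l add0r; exact: l2_partial.
Qed.

Lemma l2_cons x : l2 (coshift x) -> l2 x.
Proof.
move=> lx; pose M := vdot (x 0%N) (x 0%N) + l2dot (coshift x) (coshift x).
apply: (@l2_bounded _ M) => -[|N].
  by rewrite big_ord0 addr_ge0 ?vdot_ge0 ?l2dot_ge0.
by rewrite big_ord_recl lerD2l; apply: l2_partial.
Qed.

Lemma l2dot_shiftl x y : l2 x -> l2 y -> l2dot (fshift x) y = l2dot x (coshift y).
Proof.
move=> lx ly; rewrite l2dot_cons ?vdot0l ?add0r//; first exact: l2_shift.
exact: l2_coshift.
Qed.

Lemma l2dot_shift x y : l2 x -> l2 y -> l2dot (fshift x) (fshift y) = l2dot x y.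
Proof. by move=> lx ly; rewrite l2dot_shiftl//; apply: l2_shift. Qed.

Lemma l2_embed u : l2 (embed u).
Proof.
apply: l2_cons; rewrite (_ : coshift _ = 0); last by apply/funext.
exact: l20.
Qed.

(** The sequences S^k E u separate the points of l2, so identities between
    adjoints are checked on them. *)
Definition monomial k u : nat -> 'cV[C]_n := iter k fshift (embed u).

Lemma l2_monomial k u : l2 (monomial k u).
Proof. by elim: k => [|k IH]; [apply: l2_embed | apply: l2_shift]. Qed.

Lemma l2dot_monomial k u x : l2 x -> l2dot (monomial k u) x = vdot u (x k).
Proof.
elim: k x => [|k IH] x lx; first exact: l2dot_embed.
by rewrite l2dot_shiftl ?IH//; [apply: l2_coshift | apply: l2_monomial].
Qed.

Lemma l2_ext x y : l2 x -> l2 y ->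
  (forall k u, l2dot (monomial k u) x = l2dot (monomial k u) y) -> x = y.
Proof.
move=> lx ly xy; apply/funext => k; apply: vdot_ext => u.
by rewrite -!l2dot_monomial.
Qed.

(** ** Completeness *)

Lemma cvg_geometric_increments (u : nat -> C) :
  (forall k, `|u k.+1 - u k| <= 2^-1 ^+ k) -> cvgn u.
Proof.
move=> uk; have h : cvgn (series (fun k => u k.+1 - u k)).
  apply: (absum_cvg hC (M := 1 / (1 - 2^-1))); apply: absum_geometric => [||k].
  - by rewrite invr_ge0.
  - by rewrite invf_lt1// ltr1n.
  - by rewrite mul1r.
apply: (cvgP (u 0%N + limn (series (fun k => u k.+1 - u k)))).
apply: (cvg_ext (cvgD (cvg_cst (u 0%N)) h)) => N.
by rewrite fctE seriesEnat /= telescope_sumr// addrC subrK.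
Qed.

(** Only sequences with a geometric rate are considered, since their coordinates
    converge by absolute convergence of the increments. *)
Lemma l2_complete (xs : nat -> nat -> 'cV[C]_n) : (forall j, l2 (xs j)) ->
  (forall i j, (i <= j)%N ->
     l2dot (xs j - xs i) (xs j - xs i) <= (2^-1 ^+ i) ^+ 2) ->
  exists2 x, l2 x & forall i, l2dot (x - xs i) (x - xs i) <= (2^-1 ^+ i) ^+ 2.
Proof.
move=> lxs hxs; have lB i j := l2B (lxs j) (lxs i).
have hc k e : cvgn (fun j => xs j k e ord0).
  apply: cvg_geometric_increments => j.
  rewrite -ler_sqr ?nnegrE// ?exprn_ge0 ?invr_ge0//.
  apply: le_trans (hxs _ _ (leqnSn j)); apply: le_trans (l2_entry_le k (lB _ _)).
  by have := vdot_entry_le ((xs j.+1 - xs j) k) e; rewrite !mxE.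
pose x k : 'cV[C]_n := \col_e limn (fun j => xs j k e ord0).
have hx i N : \sum_(k < N) vdot ((x - xs i) k) ((x - xs i) k) <= (2^-1 ^+ i) ^+ 2.
  have lim_i : (fun j => \sum_(k < N)
        vdot ((xs (j + i)%N - xs i) k) ((xs (j + i)%N - xs i) k)) @ \oo -->
      \sum_(k < N) vdot ((x - xs i) k) ((x - xs i) k).
    apply: cvg_sum => k; rewrite vdot_sqE.
    apply: cvg_ext _ (fun j => esym (vdot_sqE _)).
    apply: cvg_sum => e; apply: cvgn_pow; apply: cvg_norm.
    have h := hc k e; rewrite /= -(cvg_shiftn i) /= in h.
    rewrite !mxE; apply: cvg_ext (cvgB h (cvg_cst (xs i k e ord0))) _ => j.
    by rewrite !mxE.
  apply: (cvg_le_cst lim_i) => j.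
  exact: le_trans (l2_partial N (lB _ _)) (hxs _ _ (leq_addl _ _)).
exists x => [|i]; last by apply: l2dot_le.
by rewrite -(subrK (xs 0%N) x); apply: l2D => //; apply: l2_bounded (hx 0%N).
Qed.
End L2.
Arguments l20 {C} hC n.
Arguments l2_embed {C} hC {n} u.
Arguments l2_monomial {C} hC {n} k u.

(** * A Lax-Milgram theorem *)

Definition l2linear {C : numClosedFieldType} {s r : nat}
    (A : (nat -> 'cV[C]_s) -> (nat -> 'cV[C]_r)) : Prop :=
  forall a x y, l2 x -> l2 y -> A (a *: x + y) = a *: A x + A y.

Section L2Linear.
Variables (C : numClosedFieldType) (s r : nat).
Variable A : (nat -> 'cV[C]_s) -> (nat -> 'cV[C]_r).
Hypothesis (hC : order_complete C) (linA : l2linear A).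

Lemma l2linear0 : A 0 = 0.
Proof.
have := linA (-1) (l20 hC s) (l20 hC s).
by rewrite scaler0 add0r scaleN1r addNr.
Qed.

Lemma l2linearD x y : l2 x -> l2 y -> A (x + y) = A x + A y.
Proof. by move=> lx ly; rewrite -[x]scale1r linA// !scale1r. Qed.

Lemma l2linearZ a x : l2 x -> A (a *: x) = a *: A x.
Proof.
by move=> lx; rewrite -[a *: x]addr0 linA ?l2linear0 ?addr0//; apply: l20.
Qed.

Lemma l2linearB x y : l2 x -> l2 y -> A (x - y) = A x - A y.
Proof.
by move=> lx ly; rewrite -scaleN1r addrC linA// scaleN1r addrC.
Qed.
End L2Linear.

Section LaxMilgram.
Variables (C : numClosedFieldType) (n : nat).
Hypothesis hC : order_complete C.
Variables (A B : (nat -> 'cV[C]_n) -> (nat -> 'cV[C]_n)) (c : C).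
Hypotheses (c0 : 0 < c) (linA : l2linear A) (l2A : forall x, l2 x -> l2 (A x)).
Hypothesis AB : is_adjoint A B.
Hypothesis coerA : forall x, l2 x -> c * l2dot x x <= `|l2dot (A x) x|.

Lemma coercive_lower_bound x : l2 x -> c ^+ 2 * l2dot x x <= l2dot (A x) (A x).
Proof.
move=> lx; have x0 := l2dot_ge0 lx.
have [->|xn0] := eqVneq (l2dot x x) 0.
  by rewrite mulr0; apply: l2dot_ge0; apply: l2A.
have xp : 0 < l2dot x x by rewrite lt_neqAle eq_sym xn0.
rewrite -(ler_pM2r xp) -mulrA -expr2 -exprMn.
apply: le_trans (l2_cauchy_schwarz hC (l2A lx) lx).
by rewrite ler_sqr ?nnegrE ?coerA// mulr_ge0// ltW.
Qed.

Lemma coercive_inj x y : l2 x -> l2 y -> A x = A y -> x = y.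
Proof.
move=> lx ly Axy; apply/eqP; rewrite -subr_eq0; apply/eqP.
have lxy := l2B hC lx ly; apply: (l2dot_eq0 lxy).
have := coerA lxy; rewrite (l2linearB linA lx ly) Axy subrr (l2dot0l hC lxy).
rewrite normr0 pmulr_rle0// => h; apply/eqP; rewrite eq_le h /=.
exact: l2dot_ge0.
Qed.

Let l2sq_subE (e g : nat -> 'cV[C]_n) (t : C) : l2 e -> l2 g ->
  l2dot (e - t *: g) (e - t *: g) =
  l2dot e e - t^* * l2dot e g - t * (l2dot e g)^* + t * t^* * l2dot g g.
Proof.
move=> le lg; have lt : l2 (t *: g) by apply: l2Z.
have leg := l2B hC le lt.
rewrite (l2dotBl hC le lt leg) (l2dotBr hC le lt le) (l2dotBr hC le lt lt).
rewrite (l2dotZl hC _ lg le) (l2dotZl hC _ lg lt).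
rewrite (l2dotZr hC _ le lg) (l2dotZr hC _ lg lg).
rewrite (l2dotC hC le lg); ring.
Qed.

Let parallelogram (e g : nat -> 'cV[C]_n) : l2 e -> l2 g ->
  l2dot (e - g) (e - g) = 2 * l2dot e e + 2 * l2dot g g -
    4 * l2dot (e - 2^-1 *: (e - g)) (e - 2^-1 *: (e - g)).
Proof.
move=> le lg; have leg := l2B hC le lg; rewrite l2sq_subE//.
have := l2sq_subE 1 le lg; rewrite scale1r rmorph1 !mul1r => ->.
rewrite (l2dotBr hC le lg le) rmorphB /= fmorphV /= conjC_nat.
rewrite (conj_Creal (ger0_real (l2dot_ge0 le))).
by field.
Qed.

(* The minimum of |e - t g|^2 over t is |e|^2 - |<e, g>|^2 / |g|^2. *)
Let near_minimal_corr (e g : nat -> 'cV[C]_n) (m : C) : l2 e -> l2 g ->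
  (forall t, m <= l2dot (e - t *: g) (e - t *: g)) ->
  `|l2dot e g| ^+ 2 <= (l2dot e e - m) * l2dot g g.
Proof.
move=> le lg em; have g0 := l2dot_ge0 lg.
have [gg0|gn0] := eqVneq (l2dot g g) 0.
  by rewrite (l2dot_eq0 lg gg0) !(l2dot0r hC) ?normr0 ?expr0n ?mulr0//; apply: l20.
have gp : 0 < l2dot g g by rewrite lt_neqAle eq_sym gn0.
have := em (l2dot e g / l2dot g g); rewrite l2sq_subE//.
rewrite rmorphM /= fmorphV /= (conj_Creal (ger0_real g0)).
set E := l2dot e e; set G := l2dot g g in gp gn0 *; set p := l2dot e g.
have -> : E - p^* / G * p - p / G * p^* + p / G * (p^* / G) * G = E - p * p^* / G.
  by field.
by rewrite -normCK lerBrDr addrC -lerBrDr ler_pdivrMr.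
Qed.

(** A sequence x_i minimizing |w - A x|^2 is Cauchy by the parallelogram law and
    coercivity; let x be its limit.  The residue w - A x_i is nearly orthogonal
    to Im A, and the weak convergence of A x_i to A x, which the adjoint B provides,
    carries this to the limit.  So w - A x is orthogonal to Im A, and it vanishes
    by coercivity. *)
Lemma coercive_surj w : l2 w -> exists2 x, l2 x & A x = w.
Proof.
move=> lw; pose f x := l2dot (w - A x) (w - A x).
have lwA x : l2 x -> l2 (w - A x) by move=> lx; apply: l2B => //; apply: l2A.
have f0 x : l2 x -> 0 <= f x by move=> lx; apply: l2dot_ge0; apply: lwA.
have l0 := l20 hC n.
have [|d []||m [mu ml]] := @hC [set d | 0 <= d /\ forall x, l2 x -> d <= f x].
- by exists 0; split.
- by [].
- by exists (f 0) => d [_ df]; apply: df.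
have mf x : l2 x -> m <= f x by move=> lx; apply: ml => d [_]; apply.
have m0 : 0 <= m by apply: mu; split.
have inf e : 0 < e -> exists2 x, l2 x & f x <= m + e.
  move=> e0; apply: contrapT => /forall2NP h.
  suff /mu : 0 <= m + e /\ forall x, l2 x -> m + e <= f x.
    by rewrite gerDl => /le_lt_trans/(_ e0); rewrite ltxx.
  split=> [|x lx]; first by rewrite addr_ge0// ltW.
  have me : m + e \is Num.real by rewrite ger0_real// addr_ge0// ltW.
  by have [//|] := real_leP me (ger0_real (f0 _ lx)) => /ltW; have [] := h x.
(* chosen so that c^2 |x_j - x_i|^2 <= 4 eps_i becomes the rate 4^-i *)
pose eps i := c ^+ 2 / 4 * (2^-1 ^+ i) ^+ 2.
have eps0 i : 0 < eps i by rewrite mulr_gt0 ?divr_gt0 ?exprn_gt0 ?invr_gt0.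
have /boolp.choice[xs hxs] : forall i, exists x, l2 x /\ f x <= m + eps i.
  by move=> i; have [x] := inf _ (eps0 i); exists x.
have lxs i := (hxs i).1; have fxs i : f (xs i) - m <= eps i.
  by rewrite lerBlDl; apply: (hxs i).2.
have epsh i j : (i <= j)%N -> eps j <= eps i.
  move=> ij; rewrite /eps ler_pM2l ?divr_gt0 ?exprn_gt0//.
  by rewrite -!exprM ler_wiXn2l ?invr_ge0// ?invf_le1 ?ler1n// ?leq_mul2r ?ij ?orbT.
have cauchy_xs i j : (i <= j)%N ->
    l2dot (xs j - xs i) (xs j - xs i) <= (2^-1 ^+ i) ^+ 2.
  move=> ij; have lij := l2B hC (lxs j) (lxs i).
  have c2 : 0 < c ^+ 2 by rewrite exprn_gt0.
  rewrite -(ler_pM2l c2); apply: le_trans (coercive_lower_bound lij) _.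
  have Aij : A (xs j - xs i) = (w - A (xs i)) - (w - A (xs j)).
    by rewrite (l2linearB linA)// opprB [RHS]addrC addrA subrK.
  have := parallelogram (lwA _ (lxs i)) (lwA _ (lxs j)); rewrite -Aij => ->.
  have -> : w - A (xs i) - 2^-1 *: A (xs j - xs i) =
            w - A (xs i + 2^-1 *: (xs j - xs i)).
    rewrite (l2linearD linA (lxs i) (l2Z hC lij)) (l2linearZ hC linA _ lij).
    by rewrite opprD addrA.
  have := mf (xs i + 2^-1 *: (xs j - xs i)) (l2D hC (lxs i) (l2Z hC lij)).
  have := fxs i; have := le_trans (fxs j) (epsh _ _ ij).
  rewrite -/(f _) -/(f _) -/(f _).
  move: (f _) (f _) (f _) => fj fi fm hj hi hm.
  have -> : c ^+ 2 * (2^-1 ^+ i) ^+ 2 = 2 * (m + eps i) + 2 * (m + eps i) - 4 * m.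
    by rewrite /eps; field.
  by rewrite lerB ?lerD ?ler_pM2l// -lerBlDl.
have [x lx xx] := l2_complete hC lxs cauchy_xs; exists x => //.
have orth h : l2 h -> l2dot (w - A x) (A h) = 0.
  move=> lh; have lAh := l2A lh; have lBAh := AB.1 _ lAh.
  pose K := 2 * (c ^+ 2 / 4 * l2dot (A h) (A h) + l2dot (B (A h)) (B (A h))).
  have bnd i : `|l2dot (w - A x) (A h)| ^+ 2 <= (2^-1 ^+ i) ^+ 2 * K.
    have lxi := l2B hC lx (lxs i).
    have -> : w - A x = (w - A (xs i)) - A (x - xs i).
      by rewrite (l2linearB linA)// opprB addrA subrK.
    rewrite (l2dotBl hC (lwA _ (lxs i)) (l2A lxi) lAh) AB.2//.
    have h1 : `|l2dot (w - A (xs i)) (A h)| ^+ 2 <= eps i * l2dot (A h) (A h).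
      apply: le_trans (near_minimal_corr (m := m) (lwA _ (lxs i)) lAh _) _ => [t|].
        rewrite -addrA -opprD -(l2linearZ hC linA _ lh).
        rewrite -(l2linearD linA (lxs i) (l2Z hC lh)).
        by apply: mf; apply: l2D => //; apply: l2Z.
      by apply: ler_wpM2r (fxs i); apply: l2dot_ge0.
    have h2 : `|l2dot (x - xs i) (B (A h))| ^+ 2 <=
        (2^-1 ^+ i) ^+ 2 * l2dot (B (A h)) (B (A h)).
      apply: le_trans (l2_cauchy_schwarz hC lxi lBAh) _.
      by apply: ler_wpM2r (xx i); apply: l2dot_ge0.
    move: h1 h2; move: (l2dot (w - A (xs i)) _) (l2dot (x - xs i) _) => a b ha hb.
    have -> : (2^-1 ^+ i) ^+ 2 * K =
       2 * (eps i * l2dot (A h) (A h) + (2^-1 ^+ i) ^+ 2 * l2dot (B (A h)) (B (A h))).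
      by rewrite /K /eps; ring.
    apply: le_trans (ler_wpM2l _ (lerD ha hb)) => //.
    rewrite -subr_ge0.
    have -> : 2 * (`|a| ^+ 2 + `|b| ^+ 2) - `|a - b| ^+ 2 = `|a + b| ^+ 2.
      by rewrite !normCK rmorphB rmorphD /=; ring.
    by rewrite exprn_ge0.
  apply/eqP; rewrite -normr_eq0 -sqrf_eq0 eq_le exprn_ge0// andbT.
  have h0 : (fun i => (2^-1 ^+ i) ^+ 2 * K) @ \oo --> (0 : C).
    rewrite -[X in _ --> X](mul0r K).
    apply: cvgMr_tmp; rewrite -[X in _ --> X](expr0n _ 2); apply: cvgn_pow.
    by apply: (cvg_exprn0 hC); rewrite gtr0_norm ?invr_gt0// invf_lt1// ltr1n.
  exact: (cvg_ge_cst h0).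
apply/eqP; rewrite eq_sym -subr_eq0; apply/eqP/l2dot_eq0; first exact: lwA.
have lr := lwA _ lx; have := coerA lr.
rewrite (l2dotC hC lr (l2A lr)) orth// norm_conjC normr0 pmulr_rle0// => h.
by apply/eqP; rewrite eq_le h l2dot_ge0.
Qed.

(** Coercivity bounds the modulus of <A x, x> from below, so that the theorem applies
    to I - z S* as well as to the selfadjoint T T*. *)
Lemma lax_milgram : exists A', is_inverse A A'.
Proof.
pose A' w := xget 0 [set x | l2 x /\ A x = w].
have hA' w : l2 w -> l2 (A' w) /\ A (A' w) = w.
  move=> lw; have [x lx Ax] := coercive_surj lw.
  by apply: (@xgetPex _ _ [set x | l2 x /\ A x = w]); exists x.
exists A' => x lx; have [l1 e1] := hA' _ lx; split=> //.
have [l2 e2] := hA' _ (l2A lx).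
exact: coercive_inj.
Qed.
End LaxMilgram.

(** * Convolution and matrix power series *)

Definition conv {C : numClosedFieldType} {r s t : nat}
    (a : nat -> 'M[C]_(r, s)) (b : nat -> 'M[C]_(s, t)) (n : nat) : 'M[C]_(r, t) :=
  \sum_(j < n.+1) a (n - j)%N *m b j.

Definition has_mxtaylor {C : numClosedFieldType} {r s : nat}
    (F : C -> 'M[C]_(r, s)) (a : nat -> 'M[C]_(r, s)) : Prop :=
  forall i j, has_taylor (fun z => F z i j) (fun n => a n i j).

Section Conv.
Variable C : numClosedFieldType.
Variables (r s : nat).
Implicit Types (a : nat -> 'M[C]_(r, s)) (x y : nat -> 'cV[C]_s).

Lemma conv_linear a c x y : conv a (c *: x + y) = c *: conv a x + conv a y.
Proof.
apply/funext => n; rewrite /conv; rewrite !fctE scaler_sumr -big_split.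
by apply: eq_bigr => j _; rewrite /= mulmxDr -scalemxAr.
Qed.

Lemma convD a x y : conv a (x + y) = conv a x + conv a y.
Proof. by rewrite -[x]scale1r conv_linear !scale1r. Qed.

Lemma convB a x y : conv a (x - y) = conv a x - conv a y.
Proof. by rewrite -scaleN1r addrC conv_linear scaleN1r addrC. Qed.

Lemma conv_shift a x : conv a (fshift x) = fshift (conv a x).
Proof.
apply/funext => -[|n]; rewrite /conv.
  by rewrite big_ord_recl big_ord0 /= mulmx0 addr0.
by rewrite big_ord_recl /= mulmx0 add0r.
Qed.

Lemma conv_embed a u n : conv a (embed u) n = a n *m u.
Proof.
by rewrite /conv big_ord_recl big1 ?addr0 ?subn0// => j _; rewrite mulmx0.
Qed.

Lemma conv_coshift a x :
  coshift (conv a x) = (fun n => a n.+1 *m x 0%N) + conv a (coshift x).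
Proof. by apply/funext => n; rewrite /coshift /conv big_ord_recl. Qed.

Lemma conv_truncate a x y n : (forall k, (k <= n)%N -> x k = y k) ->
  conv a x n = conv a y n.
Proof.
by move=> xy; apply: eq_bigr => j _; rewrite xy// -ltnS.
Qed.

Lemma shiftK x : coshift (fshift x) = x. Proof. by []. Qed.

Lemma embed_shift_coshift x : x = embed (x 0%N) + fshift (coshift x).
Proof. by apply/funext => -[|n]; rewrite !fctE /= ?addr0 ?add0r. Qed.

Lemma mx_of_mulmx (f : 'cV[C]_s -> 'cV[C]_r) u :
  (forall c v w, f (c *: v + w) = c *: f v + f w) -> mx_of f *m u = f u.
Proof.
move=> lf; have f0 : f 0 = 0.
  by have := lf (-1) 0 0; rewrite scaler0 add0r scaleN1r addNr.
have -> : f u = \sum_j u j ord0 *: f (delta_mx j ord0).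
  rewrite {1}[u]matrix_sum_delta.
  under eq_bigr do rewrite big_ord1.
  elim/big_rec2: _ => // j v w _ <-; exact: lf.
apply/colP => i; rewrite mxE summxE; apply: eq_bigr => j _.
by rewrite !mxE mulrC.
Qed.
End Conv.

Section MxTaylor.
Variable C : numClosedFieldType.
Hypothesis hC : order_complete C.

Lemma mxtaylorE r s (F : C -> 'M[C]_(r, s)) a : has_mxtaylor F a -> mxtaylor F = a.
Proof.
move=> Fa; apply/funext => n; apply/matrixP => i j.
by rewrite mxE (taylorE (Fa i j)).
Qed.

Lemma has_mxtaylor_mxtaylor r s (F : C -> 'M[C]_(r, s)) :
  (forall i j, analytic (fun z => F z i j)) -> has_mxtaylor F (mxtaylor F).
Proof.
move=> anF i j; apply: (has_taylor_ext (has_taylor_taylor (anF i j))) => // n.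
by rewrite mxE.
Qed.

Lemma has_mxtaylor_ext r s (F F' : C -> 'M[C]_(r, s)) a :
  has_mxtaylor F a -> (forall z, `|z| < 1 -> F z = F' z) -> has_mxtaylor F' a.
Proof. by move=> Fa FF' i j; apply: (has_taylor_ext (Fa i j)) => // z /FF' ->. Qed.

Lemma has_mxtaylor_inj r s (F F' : C -> 'M[C]_(r, s)) a : has_mxtaylor F a ->
  has_mxtaylor F' a -> forall z, `|z| < 1 -> F z = F' z.
Proof.
move=> Fa F'a z z1; apply/matrixP => i j.
exact: cvgn_unique (Fa i j z z1) (F'a i j z z1).
Qed.

Lemma has_mxtaylorD r s (F F' : C -> 'M[C]_(r, s)) a a' : has_mxtaylor F a ->
  has_mxtaylor F' a' -> has_mxtaylor (fun z => F z + F' z) (fun n => a n + a' n).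
Proof.
move=> Fa Fa' i j.
by apply: has_taylor_ext (has_taylorD (Fa i j) (Fa' i j)) _ _ => *; rewrite mxE.
Qed.

Lemma has_mxtaylorM r s t (F : C -> 'M[C]_(r, s)) (H : C -> 'M[C]_(s, t)) a b :
  has_mxtaylor F a -> has_mxtaylor H b ->
  has_mxtaylor (fun z => F z *m H z) (conv a b).
Proof.
move=> Fa Hb i j.
have := has_taylor_sum (s := index_enum 'I_s)
  (fun l => has_taylorM hC (Fa i l) (Hb l j)).
move=> /has_taylor_ext; apply => [z _|n]; first by rewrite mxE.
by rewrite exchange_big summxE; apply: eq_bigr => l _; rewrite mxE.
Qed.

Lemma has_mxtaylor_cst r s (A : 'M[C]_(r, s)) :
  has_mxtaylor (fun=> A) (fun n => if n is 0%N then A else 0).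
Proof.
move=> i j z z1; rewrite /= -cvg_shiftS; apply: cvg_ext (cvg_cst (A i j)) _ => n.
rewrite seriesEnat /= big_nat_recl//= expr0 mulr1 big1 ?addr0// => k _.
by rewrite mxE mul0r.
Qed.

Lemma has_mxtaylorMr r s t (F : C -> 'M[C]_(r, s)) a (U : 'M[C]_(s, t)) :
  has_mxtaylor F a -> has_mxtaylor (fun z => F z *m U) (fun n => a n *m U).
Proof.
move=> Fa; have := has_mxtaylorM Fa (@has_mxtaylor_cst _ _ U).
congr (has_mxtaylor _ _); apply/funext => n.
by rewrite /conv big_ord_recl big1 ?addr0 ?subn0// => j _; rewrite mulmx0.
Qed.

Lemma bounded_has_taylor (a : nat -> C) K : (forall n, `|a n| <= K) ->
  has_taylor (fun z => limn (series (fun n => a n * z ^+ n))) a.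
Proof.
move=> aK z z1; apply: (absum_cvg hC (M := K / (1 - `|z|))).
apply: absum_geometric => // n.
by rewrite normrM normrX ler_wpM2r ?exprn_ge0.
Qed.

Lemma l2_has_mxtaylor r s (a : nat -> 'M[C]_(r, s)) :
  (forall j, l2 (fun n => col j (a n))) ->
  has_mxtaylor
    (fun z => \matrix_(i, j) limn (series (fun n => a n i j * z ^+ n))) a.
Proof.
move=> la i j; set M := l2dot (fun n => col j (a n)) (fun n => col j (a n)).
apply: has_taylor_ext (bounded_has_taylor (K := M + 1) _) _ _ => [n|z _|//];
  last by rewrite mxE.
(* |a|^2 <= M implies |a| <= M + 1 *)
have h : `|a n i j| ^+ 2 <= M.
  apply: le_trans (l2_entry_le n (la j)); rewrite -/(col j (a n)).
  by apply: le_trans (vdot_entry_le _ i); rewrite mxE.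
have M0 : 0 <= M by apply: le_trans h; rewrite exprn_ge0.
rewrite -ler_sqr ?nnegrE ?addr_ge0//; apply: le_trans h _.
have -> : (M + 1) ^+ 2 = M + (M * M + M + 1) by ring.
by rewrite lerDl !addr_ge0 ?mulr_ge0.
Qed.

Lemma H2mx_of_l2_cols r s (F : C -> 'M[C]_(r, s)) a : has_mxtaylor F a ->
  (forall j, l2 (fun n => col j (a n))) -> H2mx F.
Proof.
move=> Fa la i j; split; first by exists (fun n => a n i j); apply: Fa.
rewrite (taylorE (Fa i j)).
pose M := l2dot (fun n => col j (a n)) (fun n => col j (a n)).
apply: (cvg_series_ge0 hC (M := M)) => [n|N].
  by rewrite exprn_ge0.
apply: le_trans (l2_partial N (la j)); rewrite big_mkord; apply: ler_sum => n _.
by apply: le_trans (vdot_entry_le _ i); rewrite mxE.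
Qed.

Lemma H2mx_has_mxtaylor r s (F : C -> 'M[C]_(r, s)) :
  H2mx F -> has_mxtaylor F (mxtaylor F).
Proof. by move=> hF; apply: has_mxtaylor_mxtaylor => i j; have [] := hF i j. Qed.

Lemma Hinfmx_has_mxtaylor r s (F : C -> 'M[C]_(r, s)) :
  Hinfmx F -> has_mxtaylor F (mxtaylor F).
Proof. by move=> hF; apply: has_mxtaylor_mxtaylor => i j; have [] := hF i j. Qed.

Lemma l2_mulmx r s (a : nat -> 'M[C]_(r, s)) u :
  (forall i j, exists B, forall N, \sum_(n < N) `|a n i j| ^+ 2 <= B) ->
  l2 (fun n => a n *m u).
Proof.
move=> ha.
have lcol j : l2 (fun n => col j (a n)).
  have /boolp.choice[B hB] := fun i => ha i j.
  apply: (l2_bounded hC (M := \sum_i B i)) => N.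
  under eq_bigr do rewrite vdot_sqE.
  rewrite exchange_big; apply: ler_sum => i _.
  by apply: le_trans (hB i N); apply: ler_sum => n _; rewrite mxE.
have -> : (fun n => a n *m u) = \sum_j (u j ord0 *: (fun n => col j (a n))).
  apply/funext => n; rewrite fct_sumE; apply/colP => i; rewrite summxE mxE.
  by apply: eq_bigr => j _; rewrite !fctE !mxE mulrC.
elim/big_ind: _ => [|x y lx ly|j _]; first exact: l20.
  exact: l2D.
exact: l2Z.
Qed.

Lemma H2mx_l2 r s (F : C -> 'M[C]_(r, s)) u :
  H2mx F -> l2 (fun n => mxtaylor F n *m u).
Proof.
move=> hF; apply: l2_mulmx => i j; have [_ cvF] := hF i j.
have [B B0 hB] := cvgn_bounded cvF.
exists B => N; apply: le_trans (hB N); rewrite seriesEord /= ger0_norm.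
  by apply: ler_sum => n _; rewrite mxE.
by rewrite sumr_ge0// => n _; rewrite exprn_ge0.
Qed.

Lemma Hinfmx_l2 r s (F : C -> 'M[C]_(r, s)) u :
  Hinfmx F -> l2 (fun n => mxtaylor F n *m u).
Proof.
move=> hF; apply: l2_mulmx => i j; have [B hB] := Hinf_square_summable hC (hF i j).
by exists B => N; apply: le_trans (hB N); apply: ler_sum => n _; rewrite mxE.
Qed.
End MxTaylor.

(** * The Bezout equation for coefficient sequences *)

(** Here g is the sequence of coefficients of G; the adjoint B of T and the inverse
    of T B are given by their defining properties on l2. *)
Section Bezout.
Local Open Scope sesquilinear_scope.
Variables (C : numClosedFieldType) (m p : nat).
Hypothesis hC : order_complete C.
Variable g : nat -> 'M[C]_(m, p).
Variable B : (nat -> 'cV[C]_m) -> (nat -> 'cV[C]_p).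
Variable Ainv : (nat -> 'cV[C]_m) -> (nat -> 'cV[C]_m).
Local Notation T := (conv g).
Definition symbol_col u : nat -> 'cV[C]_m := fun n => g n *m u.
Local Notation g_ := symbol_col.
Hypothesis l2g : forall u, l2 (g_ u).
Hypothesis TB : is_adjoint T B.
Hypothesis AAinv : is_inverse (T \o B) Ainv.

Implicit Types (u v w : 'cV[C]_p) (x y : nat -> 'cV[C]_p) (b d : nat -> 'cV[C]_m).

Lemma conv_monomial_l2 k u : l2 (T (monomial k u)).
Proof.
elim: k => [|k IH] /=; last by rewrite conv_shift; apply: l2_shift.
have -> : T (embed u) = g_ u by apply/funext => n; rewrite conv_embed.
exact: l2g.
Qed.

Lemma l2_adj b : l2 b -> l2 (B b). Proof. exact: TB.1. Qed.

Lemma adj_linear : l2linear B.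
Proof.
move=> c b d lb ld; have lcb : l2 (c *: b) by apply: l2Z.
have lBb := l2_adj lb; have lBd := l2_adj ld.
have lcBb : l2 (c *: B b) by apply: l2Z.
have lm k u := l2_monomial hC k u; have lTm := conv_monomial_l2.
apply: (l2_ext hC) => [||k u]; [by apply: l2_adj; apply: l2D|exact: l2D|].
rewrite -(TB.2 _ _ (lm k u) (l2D hC lcb ld)).
rewrite (l2dotDr hC lcb ld (lTm _ _)) (l2dotZr hC _ (lTm _ _) lb).
rewrite (l2dotDr hC lcBb lBd (lm _ _)) (l2dotZr hC _ (lm _ _) lBb).
by rewrite (TB.2 _ _ (lm k u) lb) (TB.2 _ _ (lm k u) ld).
Qed.

(** The adjoint of the relation T S = S T. *)
Lemma adj_coshift b : l2 b -> coshift (B b) = B (coshift b).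
Proof.
move=> lb; have lBb := l2_adj lb; have lcb := l2_coshift hC lb.
apply: (l2_ext hC) => [||k u]; [exact: l2_coshift|exact: l2_adj|].
have lm := l2_monomial hC k u.
have lTm : l2 (T (monomial k u)) by apply: conv_monomial_l2.
rewrite -l2dot_shiftl// -!TB.2//; last exact: l2_shift.
by rewrite conv_shift l2dot_shiftl.
Qed.

Lemma inv_linear : l2linear Ainv.
Proof.
move=> c b d lb ld; have [lib Ab _] := AAinv lb; have [lid Ad _] := AAinv ld.
have lcib : l2 (c *: Ainv b) by apply: l2Z.
have [_ _ <-] := AAinv (l2D hC lcib lid); congr Ainv.
by rewrite -[in LHS]Ab -[in LHS]Ad /= adj_linear// conv_linear.
Qed.

Definition rinv : (nat -> 'cV[C]_m) -> (nat -> 'cV[C]_p) := B \o Ainv.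
Local Notation R := rinv.

Lemma l2_rinv b : l2 b -> l2 (R b).
Proof. by move=> lb; apply: l2_adj; have [] := AAinv lb. Qed.

Lemma rinv_linear : l2linear R.
Proof.
move=> c b d lb ld; rewrite /rinv /= inv_linear// adj_linear//.
  by have [] := AAinv lb.
by have [] := AAinv ld.
Qed.

Lemma rinvK b : l2 b -> T (R b) = b.
Proof. by move=> lb; have [] := AAinv lb. Qed.

Lemma rinv_adjK b : l2 b -> R (T (B b)) = B b.
Proof. by move=> lb; rewrite /rinv /=; have [_ _ ->] := AAinv lb. Qed.

Lemma ker_perp_adj y b : l2 y -> l2 b -> T y = 0 -> l2dot y (B b) = 0.
Proof. by move=> ly lb Ty; rewrite -TB.2// Ty l2dot0l. Qed.

(** The coefficients of Y u; the tail of the symbol column g u is S* T E u, which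
    is the Hankel operator of G applied to E u. *)
Definition Ycol u : nat -> 'cV[C]_p := embed u - fshift (R (coshift (g_ u))).

Lemma l2_symbol_tail u : l2 (coshift (g_ u)).
Proof. by apply: l2_coshift. Qed.

Lemma l2_Ycol u : l2 (Ycol u).
Proof.
apply: l2B => //; first exact: l2_embed.
by apply: l2_shift => //; apply: l2_rinv; apply: l2_symbol_tail.
Qed.

Lemma Ycol0 u : Ycol u 0%N = u.
Proof. by rewrite /Ycol !fctE /= subr0. Qed.

Lemma YcolS u n : Ycol u n.+1 = - R (coshift (g_ u)) n.
Proof. by rewrite /Ycol !fctE /= sub0r. Qed.

Lemma Ycol_linear c u v n : Ycol (c *: u + v) n = c *: Ycol u n + Ycol v n.
Proof.
case: n => [|n]; first by rewrite !Ycol0.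
rewrite !YcolS scalerN -opprD; congr (- _).
have -> : g_ (c *: u + v) = c *: g_ u + g_ v.
  by apply/funext => n'; rewrite /symbol_col mulmxDr -scalemxAr.
have -> : coshift (c *: g_ u + g_ v) = c *: coshift (g_ u) + coshift (g_ v) by [].
by rewrite rinv_linear//; apply: l2_symbol_tail.
Qed.

Lemma conv_Ycol u : T (Ycol u) = embed (g 0%N *m u).
Proof.
rewrite /Ycol convB conv_shift rinvK; last exact: l2_symbol_tail.
by apply/funext => -[|n]; rewrite !fctE conv_embed /= ?subr0// subrr.
Qed.

(** Comparing the tails of T r gives T S* r = - S* T E r(0), and R inverts T on
    Im T*, where S* r lies. *)
Lemma Ycol_recover r b : l2 b -> coshift r = B b -> coshift (T r) = 0 ->
  r = Ycol (r 0%N).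
Proof.
move=> lb rb Tr; rewrite {1}[r]embed_shift_coshift /Ycol; congr (_ + _).
have -> : coshift r = - R (coshift (g_ (r 0%N))).
  2: by apply/funext => -[|n]; rewrite !fctE /= ?oppr0.
have := Tr; rewrite conv_coshift rb => /(canRL (addKr _)); rewrite addr0 => TBb.
rewrite -rinv_adjK// TBb -scaleN1r (l2linearZ hC rinv_linear)//.
  by rewrite scaleN1r.
exact: l2_symbol_tail.
Qed.

(** T R E a = E a is constant, and S* R E a = T* S* (T T* )^-1 E a. *)
Lemma rinv_embed (a : 'cV[C]_m) : R (embed a) = Ycol (R (embed a) 0%N).
Proof.
have la := l2_embed hC a; have [lA _ _] := AAinv la.
apply: (@Ycol_recover _ (coshift (Ainv (embed a)))).
- exact: l2_coshift.
- by rewrite -adj_coshift.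
- by rewrite rinvK//; apply/funext.
Qed.

(** ** The projection on Ker T *)

(** The orthogonal projection of E u on Ker T. *)
Definition ker_proj u : nat -> 'cV[C]_p := embed u - R (g_ u).
Local Notation q := ker_proj.

Lemma l2_ker_proj u : l2 (q u).
Proof. by apply: l2B => //; [apply: l2_embed|apply: l2_rinv]. Qed.

Lemma conv_ker_proj u : T (q u) = 0.
Proof.
by rewrite convB rinvK//; apply/funext => n; rewrite !fctE conv_embed subrr.
Qed.

(** R T E u lies in Im T*, which is orthogonal to Ker T. *)
Lemma l2dot_ker_proj y u : l2 y -> T y = 0 -> l2dot y (q u) = vdot (y 0%N) u.
Proof.
move=> ly Ty; have lu := l2_embed hC u; have [lA _ _] := AAinv (@l2g u).
rewrite (l2dotBr hC lu (l2_rinv (@l2g u)) ly) ker_perp_adj// subr0.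
by rewrite (l2dotC hC lu ly) l2dot_embed -vdotC.
Qed.

Lemma ker_proj_Ycol u : q u = Ycol (q u 0%N).
Proof.
have [lA _ _] := AAinv (@l2g u).
apply: (@Ycol_recover _ (- coshift (Ainv (g_ u)))).
- by apply: l2N => //; apply: l2_coshift.
- rewrite -scaleN1r (l2linearZ hC adj_linear); last exact: l2_coshift.
  rewrite -adj_coshift// scaleN1r; apply/funext => n.
  by rewrite /coshift /ker_proj !fctE /= sub0r.
- by rewrite conv_ker_proj.
Qed.

(** ** The inner function *)

Variables (k : nat) (Theta0 : 'M[C]_(p, k)).
Hypothesis Theta0_fact : forall u, Theta0 *m Theta0 ^t* *m u = q u 0%N.
Hypothesis Theta0_inj : forall w : 'cV[C]_k, Theta0 *m w = 0 -> w = 0.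
Local Notation M := (Theta0 ^t* *m Theta0).
Implicit Types (a : 'cV[C]_k) (s : nat -> 'cV[C]_k).

Lemma Theta0_gram_unit : M \in unitmx.
Proof.
rewrite -unitmx_tr -row_free_unit; apply: inj_row_free => v vM.
have Mv : M *m v^T = 0 by rewrite -[M]trmxK -trmx_mul vM trmx0.
apply/(can_inj (@trmxK _ _ _)); rewrite trmx0; apply: Theta0_inj; apply: vdot_eq0.
by rewrite vdot_adj mulmxA Mv /vdot trmx0 map_mx0 mul0mx mxE.
Qed.

(** Theta0 L is the orthogonal projection on Im Theta0. *)
Definition Theta0_linv : 'M[C]_(k, p) := invmx M *m Theta0 ^t*.
Local Notation L := Theta0_linv.

Definition Theta_col a : nat -> 'cV[C]_p := Ycol (Theta0 *m a).

(** Theta0* is onto because Theta0 is injective: it maps Theta0 M^-1 a to a. *)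
Lemma Theta_col_ker_proj a : Theta_col a = q (Theta0 *m (invmx M *m a)).
Proof.
rewrite ker_proj_Ycol -Theta0_fact /Theta_col -!mulmxA; congr (Ycol (_ *m _)).
by rewrite !mulmxA mulmxV ?mul1mx// Theta0_gram_unit.
Qed.

Lemma l2_Theta_col a : l2 (Theta_col a). Proof. exact: l2_Ycol. Qed.

Lemma conv_Theta_col a : T (Theta_col a) = 0.
Proof. by rewrite Theta_col_ker_proj conv_ker_proj. Qed.

Lemma l2dot_Theta_col y a : l2 y -> T y = 0 ->
  l2dot y (Theta_col a) = vdot (y 0%N) (Theta0 *m (invmx M *m a)).
Proof. by move=> ly Ty; rewrite Theta_col_ker_proj l2dot_ker_proj. Qed.

(** If Theta0* w = 0 then q w vanishes, since |q w|^2 is the inner product of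
    q w (0) = Theta0 Theta0* w with w; so y(0) is orthogonal to w.  Thus y(0)
    is orthogonal to the kernel of Theta0*, which means that it lies in Im Theta0. *)
Lemma ker_head y : l2 y -> T y = 0 -> y 0%N = Theta0 *m (L *m y 0%N).
Proof.
move=> ly Ty; apply/eqP; rewrite -subr_eq0; apply/eqP.
set w := _ - _; have w0 : Theta0 ^t* *m w = 0.
  rewrite mulmxBr !mulmxA mulmxV ?mul1mx ?subrr//.
  by rewrite Theta0_gram_unit.
have qw0 : q w = 0.
  apply: l2dot_eq0; first exact: l2_ker_proj.
  rewrite l2dot_ker_proj ?conv_ker_proj//; last exact: l2_ker_proj.
  by rewrite -Theta0_fact -mulmxA w0 mulmx0 vdot0l.
have yw : vdot (y 0%N) w = 0.
  by rewrite -l2dot_ker_proj// qw0 l2dot0r.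
apply: vdot_eq0; rewrite {1}/w -scaleN1r vdotDl yw vdotZl vdot_adj w0 add0r.
by rewrite vdotC vdot0l conjC0 mulr0.
Qed.

(** The shifted sequence lies in Ker T and vanishes at 0, so it is orthogonal to the
    columns of Theta. *)
Lemma Theta_cons a y : l2 y -> T y = 0 ->
  [/\ l2 (Theta_col a + fshift y), T (Theta_col a + fshift y) = 0 &
    l2dot (Theta_col a + fshift y) (Theta_col a + fshift y) = vdot a a + l2dot y y].
Proof.
move=> ly Ty; have lth := @l2_Theta_col a; have ls := l2_shift hC ly.
have lD := l2D hC lth ls.
have Ts : T (fshift y) = 0 by rewrite conv_shift Ty; apply/funext => -[].
split=> //; first by rewrite convD conv_Theta_col Ts addr0.
have st : l2dot (fshift y) (Theta_col a) = 0.
  by rewrite l2dot_Theta_col//= vdot0l.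
rewrite (l2dotDl hC lth ls lD) (l2dotDr hC lth ls lth) (l2dotDr hC lth ls ls).
rewrite (l2dotC hC ls lth) st conjC0 addr0 add0r l2dot_shift//; congr (_ + _).
rewrite l2dot_Theta_col ?conv_Theta_col// /Theta_col Ycol0 vdot_adj.
by rewrite !mulmxA mulmxV ?mul1mx// Theta0_gram_unit.
Qed.

Definition Theta_coef n : 'M[C]_(p, k) := mx_of (fun u => Ycol u n) *m Theta0.
Local Notation TT := (conv Theta_coef).

Lemma Theta_coefE n a : Theta_coef n *m a = Theta_col a n.
Proof. by rewrite -mulmxA mx_of_mulmx// => c u v; rewrite Ycol_linear. Qed.

Lemma conv_Theta_cons s : TT s = Theta_col (s 0%N) + fshift (TT (coshift s)).
Proof.
rewrite {1}[s]embed_shift_coshift convD conv_shift; congr (_ + _).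
by apply/funext => n; rewrite conv_embed Theta_coefE.
Qed.

Lemma conv_Theta_fin N s : (forall j, (N <= j)%N -> s j = 0) ->
  [/\ l2 (TT s), T (TT s) = 0 & l2dot (TT s) (TT s) = \sum_(j < N) vdot (s j) (s j)].
Proof.
elim: N s => [|N IH] s sN.
  have -> : TT s = 0.
    by apply/funext => n; rewrite /conv big1// => j _; rewrite sN// mulmx0.
  rewrite big_ord0 l2dot0l//; last exact: l20.
  split=> //; first exact: l20.
  by apply/funext => n; rewrite /conv big1// => j _; rewrite mulmx0.
have [j Nj|lT TT0 nT] := IH (coshift s); first by rewrite /coshift sN.
rewrite conv_Theta_cons; have [l1 e1 e2] := Theta_cons (s 0%N) lT TT0.
by split=> //; rewrite e2 nT big_ord_recl.
Qed.

Definition truncate N s := fun j => if (j < N)%N then s j else 0.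

Lemma truncate_fin N s j : (N <= j)%N -> truncate N s j = 0.
Proof. by rewrite /truncate ltnNge => ->. Qed.

(** The first N entries of T_Theta s only involve the first N entries of s, so the
    partial sums are controlled by the case of finite support. *)
Lemma conv_Theta_l2 s : l2 s ->
  [/\ l2 (TT s), T (TT s) = 0 & l2dot (TT s) (TT s) <= l2dot s s].
Proof.
move=> ls.
have tr N n : (n < N)%N -> TT s n = TT (truncate N s) n.
  by move=> nN; apply: conv_truncate => j jn; rewrite /truncate (leq_ltn_trans jn).
have bnd N : \sum_(j < N) vdot (TT s j) (TT s j) <= l2dot s s.
  have [lT _ nT] := conv_Theta_fin (@truncate_fin N s).
  apply: le_trans (l2_partial N ls).
  have -> : \sum_(j < N) vdot (s j) (s j) =
      \sum_(j < N) vdot (truncate N s j) (truncate N s j).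
    by apply: eq_bigr => j _; rewrite /truncate ltn_ord.
  rewrite -nT; apply: le_trans (l2_partial N lT); apply: ler_sum => j _.
  by rewrite -tr.
split; [exact: l2_bounded bnd| |exact: l2dot_le bnd].
apply/funext => n; have [_ Tn _] := conv_Theta_fin (@truncate_fin n.+1 s).
rewrite -[RHS](congr1 (fun f => f n) Tn); apply: conv_truncate => j jn.
by rewrite -tr.
Qed.

(** The defect |s|^2 - |T_Theta s|^2 does not change when s is replaced by its
    tail, and it is at most the square of the norm of the tail, which tends to 0. *)
Lemma conv_Theta_isometry s : l2 s -> l2dot (TT s) (TT s) = l2dot s s.
Proof.
move=> ls; have [lTs _ dle] := conv_Theta_l2 ls.
have step N r : l2 r -> l2dot r r - l2dot (TT r) (TT r) <=
    l2dot r r - \sum_(j < N) vdot (r j) (r j).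
  elim: N r => [|N IH] r lr.
    have [lT _ _] := conv_Theta_l2 lr.
    by rewrite big_ord0 lerB// l2dot_ge0.
  have lc := l2_coshift hC lr; have [lT T0 _] := conv_Theta_l2 lc.
  have [_ _ e] := Theta_cons (r 0%N) lT T0; rewrite -conv_Theta_cons in e.
  rewrite e (l2dot_cons hC lr lr lc lc) big_ord_recl.
  by rewrite !opprD !addrA ![vdot _ _ + _]addrC !addrK IH.
apply/eqP; rewrite eq_le dle /= -subr_le0.
have h0 : (fun N => l2dot s s - series (fun j => vdot (s j) (s j)) N) @ \oo --> (0 : C).
  rewrite -[X in _ --> X](subrr (l2dot s s)); apply: cvgB; first exact: cvg_cst.
  exact: ls.
by apply: (cvg_ge_cst h0) => N; rewrite seriesEord; apply: step.
Qed.

(** By [ker_head], y(0) = Theta0 a for some a, and y - Theta a is the shift of another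
    sequence in Ker T.  Iterating produces the coefficients; their squares are
    summable because |y|^2 drops by |a|^2 at each step. *)
Lemma conv_Theta_onto y : l2 y -> T y = 0 -> exists2 s, l2 s & TT s = y.
Proof.
move=> ly Ty.
pose step y : nat -> 'cV[C]_p := coshift (y - Theta_col (L *m y 0%N)).
have stepE z : l2 z -> T z = 0 -> z = Theta_col (L *m z 0%N) + fshift (step z).
  move=> lz Tz; rewrite -[LHS](subrK (Theta_col (L *m z 0%N))) addrC; congr (_ + _).
  rewrite [LHS]embed_shift_coshift -/(step z) -[RHS]add0r; congr (_ + _).
  rewrite !fctE /Theta_col Ycol0 -ker_head// subrr.
  by apply/funext => -[].
have stepP z : l2 z -> T z = 0 ->
    [/\ l2 (step z), T (step z) = 0 &
     l2dot z z = vdot (L *m z 0%N) (L *m z 0%N) + l2dot (step z) (step z)].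
  move=> lz Tz; have lst : l2 (step z).
    by apply: l2_coshift => //; apply: l2B => //; apply: l2_Theta_col.
  have Tst : T (step z) = 0.
    have := Tz; rewrite {1}(stepE _ lz Tz) convD conv_Theta_col add0r conv_shift => h.
    by rewrite -[LHS]shiftK h.
  split=> //; have [_ _] := Theta_cons (L *m z 0%N) lst Tst.
  by rewrite -stepE.
pose ys N := iter N step y; pose s N := L *m ys N 0%N.
have ysP N : l2 (ys N) /\ T (ys N) = 0.
  by elim: N => [//|N [l1 t1]]; have [] := stepP _ l1 t1.
have nrm N : l2dot y y = \sum_(j < N) vdot (s j) (s j) + l2dot (ys N) (ys N).
  elim: N => [|N ->]; first by rewrite big_ord0 add0r.
  have [l1 t1] := ysP N; have [_ _ ->] := stepP _ l1 t1.
  by rewrite big_ord_recr /= addrA.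
exists s.
  apply: (l2_bounded hC (M := l2dot y y)) => N.
  by rewrite (nrm N) lerDl l2dot_ge0//; have [] := ysP N.
have gen n N : TT (fun j => s (N + j)%N) n = ys N n.
  elim: n N => [|n IH] N; have [l1 t1] := ysP N.
    by rewrite conv_Theta_cons [in RHS](stepE _ l1 t1) !fctE /= addn0.
  rewrite conv_Theta_cons [in RHS](stepE _ l1 t1) !fctE /= addn0; congr (_ + _).
  rewrite -[step _ n]/(ys N.+1 n) -IH; congr (conv _ _ _).
  by apply/funext => j; rewrite /coshift addnS addSn.
by apply/funext => n; rewrite -[RHS](gen n 0%N).
Qed.

(** R E e lies in Im T*, which is orthogonal to Ker T. *)
Lemma pythagoras (e : 'cV[C]_m) s : l2 s ->
  l2 (R (embed e) + TT s) /\
  l2dot (R (embed e) + TT s) (R (embed e) + TT s) =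
  l2dot (R (embed e)) (R (embed e)) + l2dot s s.
Proof.
move=> ls; have le := l2_embed hC e; have lR := l2_rinv le.
have [lT T0 _] := conv_Theta_l2 ls; have lD := l2D hC lR lT; split=> //.
have [lA _ _] := AAinv le; have c0 := ker_perp_adj lT lA T0.
rewrite (l2dotDl hC lR lT lD) (l2dotDr hC lR lT lR) (l2dotDr hC lR lT lT).
rewrite [l2dot (R _) (TT s)](l2dotC hC lT lR).
rewrite -[R (embed e)]/(B (Ainv (embed e))) c0.
by rewrite conjC0 addr0 add0r conv_Theta_isometry.
Qed.

Lemma conv_rinv_Theta (e : 'cV[C]_m) s : l2 s -> T (R (embed e) + TT s) = embed e.
Proof.
move=> ls; have [_ T0 _] := conv_Theta_l2 ls.
by rewrite convD T0 addr0 rinvK//; apply: l2_embed.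
Qed.

(** G(0) is onto since G(0) R E e (0) = e.  A vector x with G(0) x = 0 is the value
    at 0 of Y x, which lies in Ker T, so Im Theta0 = Ker G(0). *)
Lemma Theta_size : (m <= p)%N /\ k = (p - m)%N.
Proof.
pose X0 : 'M[C]_(p, m) := mx_of (fun e => R (embed e) 0%N).
have gX : g 0%N *m X0 = 1%:M.
  apply/matrixP => i j; have le := l2_embed hC (delta_mx j ord0 : 'cV[C]_m).
  have -> : (g 0%N *m X0) i j = (g 0%N *m R (embed (delta_mx j ord0)) 0%N) i ord0.
    by rewrite !mxE; apply: eq_bigr => l _; rewrite mxE.
  have := congr1 (fun f => f 0%N) (rinvK le).
  rewrite {1}/conv big_ord_recl big_ord0 addr0 => ->.
  by rewrite /= !mxE eqxx andbT.
have rg : row_free (g 0%N).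
  apply: inj_row_free => v vg; rewrite -[v]mulmx1 -gX mulmxA vg mul0mx//.
have mp : \rank (g 0%N) = m by apply/eqP.
split; first by rewrite -[X in (X <= _)%N]mp rank_leq_col.
have rT : \rank Theta0 = k.
  rewrite -mxrank_tr; apply/eqP; apply: inj_row_free => v vT.
  apply/(can_inj (@trmxK _ _ _)); rewrite trmx0; apply: Theta0_inj.
  by rewrite -(trmxK Theta0) -trmx_mul vT trmx0.
have mulmx_col r1 r2 r3 (X : 'M[C]_(r1, r2)) (Z : 'M[C]_(r2, r3)) j :
    col j (X *m Z) = X *m col j Z by rewrite !colE mulmxA.
have gT : g 0%N *m Theta0 = 0.
  apply/row_matrixP => i; apply/rowP => j.
  have := congr1 (fun f => f 0%N) (conv_Theta_col (delta_mx j ord0)).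
  rewrite /conv big_ord_recl big_ord0 addr0 /= /Theta_col Ycol0 -colE -mulmx_col.
  by move=> /(congr1 (fun A : 'cV[C]_m => A i ord0)); rewrite !mxE.
have kerg (x : 'cV[C]_p) : g 0%N *m x = 0 -> x = Theta0 *m (L *m x).
  move=> gx; rewrite -(Ycol0 x); apply: ker_head; first exact: l2_Ycol.
  by rewrite conv_Ycol gx; apply/funext => -[].
pose K := (kermx (g 0%N)^T)^T.
have gK : g 0%N *m K = 0 by rewrite -[g 0%N in LHS]trmxK -trmx_mul mulmx_ker trmx0.
have KE : K = Theta0 *m (L *m K).
  apply/matrixP => i j; have : col j K = col j (Theta0 *m (L *m K)).
    rewrite !mulmx_col; apply: kerg; rewrite -mulmx_col gK.
    by apply/colP => l; rewrite !mxE.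
  by move=> /(congr1 (fun A : 'cV[C]_p => A i ord0)); rewrite [LHS]mxE [RHS]mxE.
have rK : \rank K = (p - m)%N by rewrite mxrank_tr mxrank_ker mxrank_tr mp.
apply/eqP; rewrite eqn_leq -{1}rT -{2}rT -rK; apply/andP; split.
  rewrite rK -[X in (_ - X)%N]mp -[\rank (g _)]mxrank_tr -mxrank_ker -mxrank_tr.
  by apply: mxrankS; apply/sub_kermxP; rewrite -trmx_mul gT trmx0.
by rewrite KE; apply: mxrankM_maxl.
Qed.
End Bezout.

(** * The operators attached to a symbol *)

Section Assembly.
Local Open Scope sesquilinear_scope.
Variable C : numClosedFieldType.
Hypothesis hC : order_complete C.

Lemma adjoint_unique s r (A : (nat -> 'cV[C]_s) -> (nat -> 'cV[C]_r)) B B' y :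
  is_adjoint A B -> is_adjoint A B' -> l2 y -> B y = B' y.
Proof.
move=> AB AB' ly; apply: (l2_ext hC) => [||k u]; [exact: AB.1|exact: AB'.1|].
by rewrite -AB.2 ?AB'.2//; apply: l2_monomial.
Qed.

Lemma is_adjoint_adj s r (A : (nat -> 'cV[C]_s) -> (nat -> 'cV[C]_r)) B :
  is_adjoint A B -> is_adjoint A (adj A).
Proof. by move=> AB; apply: (@xgetPex _ _ [set B | is_adjoint A B]); exists B. Qed.

Lemma is_inverse_opinv n (A : (nat -> 'cV[C]_n) -> (nat -> 'cV[C]_n)) B :
  is_inverse A B -> is_inverse A (opinv A).
Proof. by move=> AB; apply: (@xgetPex _ _ [set B | is_inverse A B]); exists B. Qed.

(** ** The resolvent of the backward shift *)

Lemma is_adjoint_shift n : is_adjoint (@fshift C n) coshift.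
Proof. by split=> [y|x y lx ly]; [apply: l2_coshift|rewrite l2dot_shiftl]. Qed.

Lemma adj_shiftE n (x : nat -> 'cV[C]_n) : l2 x -> adj fshift x = coshift x.
Proof.
move=> lx; have hs := is_adjoint_shift n.
exact: adjoint_unique (is_adjoint_adj hs) hs lx.
Qed.

Lemma coshift_le n (x : nat -> 'cV[C]_n) : l2 x ->
  l2dot (coshift x) (coshift x) <= l2dot x x.
Proof.
move=> lx; have lc := l2_coshift hC lx.
by rewrite (l2dot_cons hC lx lx lc lc) lerDr vdot_ge0.
Qed.

(** The operator I - z S* is coercive because S* is a contraction. *)
Lemma is_inverse_coshift_resolvent n (z : C) : `|z| < 1 ->
  is_inverse (fun (x : nat -> 'cV[C]_n) k => x k - z *: adj fshift x k)
             (coshift_resolvent z).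
Proof.
move=> z1; set A := fun x k => _.
have AE x : l2 x -> A x = x - z *: coshift x.
  by move=> lx; apply/funext => k; rewrite /A adj_shiftE.
have l2c (x : nat -> 'cV[C]_n) : l2 x -> l2 (z *: coshift x).
  by move=> lx; apply: l2Z => //; apply: l2_coshift.
have l2s (y : nat -> 'cV[C]_n) : l2 y -> l2 (z^* *: fshift y).
  by move=> ly; apply: l2Z => //; apply: l2_shift.
suff [B /is_inverse_opinv] : exists B, is_inverse A B by [].
have z1' : 0 < 1 - `|z| by rewrite subr_gt0.
apply: (lax_milgram hC (B := fun y => y - z^* *: fshift y) z1').
- move=> c x y lx ly; have lcx := l2Z hC (a := c) lx.
  rewrite !AE//; last exact: l2D.
  have -> : coshift (c *: x + y) = c *: coshift x + coshift y by [].
  by rewrite scalerDr scalerBr opprD !scalerA mulrC addrACA.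
- by move=> x lx; rewrite AE//; apply: l2B => //; apply: l2c.
- split=> [y ly|x y lx ly]; first by apply: l2B => //; apply: l2s.
  have lcx := l2c _ lx; have lsy := l2s _ ly.
  rewrite AE// (l2dotBl hC lx lcx ly) (l2dotBr hC ly lsy lx); congr (_ - _).
  rewrite (l2dotZl hC _ (l2_coshift hC lx) ly).
  rewrite (l2dotZr hC _ lx (l2_shift hC ly)) conjCK.
  rewrite (l2dotC hC (l2_shift hC ly) lx) l2dot_shiftl// -l2dotC//.
  exact: l2_coshift.
- move=> x lx; rewrite AE//; have lcx := l2_coshift hC lx.
  rewrite (l2dotBl hC lx (l2c _ lx) lx) (l2dotZl hC _ lcx lx).
  have x0 := l2dot_ge0 lx.
  have h : `|l2dot (coshift x) x| <= l2dot x x.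
    rewrite -ler_sqr ?nnegrE//; apply: le_trans (l2_cauchy_schwarz hC lcx lx) _.
    by rewrite [leRHS]expr2; apply: ler_wpM2r => //; apply: coshift_le.
  apply: le_trans (lerB_dist _ _); rewrite normrM (ger0_norm x0) mulrBl mul1r.
  by rewrite lerD2l lerN2 ler_wpM2l.
Qed.

(** With y = (I - z S* )^-1 x one has x_k = y_k - z y_(k+1), so the power series of x
    telescopes to y_0. *)
Lemma coshift_resolvent_eval n (x : nat -> 'cV[C]_n) (z : C) i : l2 x -> `|z| < 1 ->
  series (fun k => x k i ord0 * z ^+ k) @ \oo --> coshift_resolvent z x 0%N i ord0.
Proof.
move=> lx z1; have [ly Ay _] := @is_inverse_coshift_resolvent n z z1 _ lx.
set y := coshift_resolvent z x in ly Ay *.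
have xy k : x k = y k - z *: y k.+1.
  by have := congr1 (fun f => f k) Ay; rewrite /= adj_shiftE.
have sE N : series (fun k => x k i ord0 * z ^+ k) N =
            y 0%N i ord0 - y N i ord0 * z ^+ N.
  elim: N => [|N IH]; first by rewrite seriesEnat /= big_geq// expr0 mulr1 subrr.
  by rewrite seriesSr IH xy !mxE exprS; ring.
apply: (cvg_ext _ (fun N => esym (sE N))).
rewrite -[X in _ --> X]subr0; apply: cvgB; first exact: cvg_cst.
have yb N : `|y N i ord0| <= l2dot y y + 1.
  have h : `|y N i ord0| ^+ 2 <= l2dot y y.
    exact: le_trans (vdot_entry_le _ i) (l2_entry_le N ly).
  have y0 := l2dot_ge0 ly.
  rewrite -ler_sqr ?nnegrE ?addr_ge0//; apply: le_trans h _.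
  have -> : (l2dot y y + 1) ^+ 2 =
      l2dot y y + (l2dot y y * l2dot y y + l2dot y y + 1) by ring.
  by rewrite lerDl !addr_ge0 ?mulr_ge0.
apply: cvg_series_cvg_0; apply: (absum_cvg hC (M := (l2dot y y + 1) / (1 - `|z|))).
by apply: absum_geometric => // N; rewrite normrM normrX ler_wpM2r ?exprn_ge0.
Qed.

Variables (m p k : nat) (G : C -> 'M[C]_(m, p)) (Theta0 : 'M[C]_(p, k)).
Hypothesis hG : Hinfmx G.
Hypothesis posG : strictly_positive (gram G).
Hypothesis hTheta0 : is_Theta0 G Theta0.

Local Notation g := (mxtaylor G).
Local Notation T := (conv g).
Local Notation B := (adj (toeplitz G)).
Local Notation Ainv := (opinv (gram G)).
Local Notation R := (rinv B Ainv).
Local Notation g_ := (symbol_col g).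

Let l2g (u : 'cV[C]_p) : l2 (g_ u).
Proof. exact: Hinfmx_l2. Qed.

(** If T had no adjoint, [adj] would be the zero map by convention and T T* would
    vanish, contradicting strict positivity unless m = 0; for m = 0 the zero map
    is an adjoint. *)
Lemma is_adjoint_toeplitz : is_adjoint T B.
Proof.
have [[D TD]|noadj] := pselect (exists D, is_adjoint (toeplitz G) D).
  exact: is_adjoint_adj TD.
have B0 : B = (fun _ _ => 0) by apply: xgetPN => D TD; apply: noadj; exists D.
have [m0|m_gt0] := posnP m; last first.
  have [_ [delta delta0 hdelta]] := posG.
  have lu := l2_embed hC (const_mx 1 : 'cV[C]_m).
  have := hdelta _ lu; rewrite [gram G _](_ : _ = 0); last first.
    rewrite /gram /= B0; apply/funext => n; rewrite /toeplitz big1// => j _.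
    by rewrite mulmx0.
  rewrite l2dot0l// l2dot_embed pmulr_rle0//= vdot_sqE.
  under eq_bigr do rewrite mxE normr1 expr1n.
  by rewrite sumr_const card_ord -[0]/(0%:R) ler_nat leqNgt m_gt0.
case: noadj; exists (fun _ _ => 0); split=> [y _|x y lx ly]; first exact: l20.
have -> : toeplitz G x = 0.
  by apply/funext => n; apply/colP => -[i im]; have := im; rewrite {1}m0.
by rewrite l2dot0l// (l2dot0r hC lx).
Qed.
Let TB := is_adjoint_toeplitz.

Lemma is_inverse_gram : is_inverse (T \o B) Ainv.
Proof.
have [gg [delta delta0 hdelta]] := posG.
suff [D /is_inverse_opinv] : exists D, is_inverse (gram G) D by [].
apply: (lax_milgram hC (B := gram G) delta0) => //.
- move=> c x y lx ly; rewrite /gram /= (adj_linear hC l2g TB)//.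
  exact: conv_linear.
- exact: gg.1.
move=> x lx; have h := hdelta x lx; rewrite ger0_norm//.
by apply: le_trans h; rewrite mulr_ge0 ?l2dot_ge0// ltW.
Qed.
Let AAinv := is_inverse_gram.

Lemma hankel_embed (u : 'cV[C]_p) : hankel G (embed u) = coshift (g_ u).
Proof.
apply/funext => i; apply/colP => l; rewrite mxE.
apply: cvg_lim => //; rewrite -cvg_shiftS.
apply: cvg_ext (cvg_cst ((g i.+1 *m u) l ord0)) _ => N.
rewrite seriesEnat /= big_nat_recl//= addn0 big1 ?addr0// => j _.
by rewrite mulmx0 mxE.
Qed.

Let R_linear := rinv_linear hC l2g TB AAinv.
Let lR := l2_rinv TB AAinv.

Lemma Xi0_mul (e : 'cV[C]_m) : Xi0 G *m e = R (embed e) 0%N.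
Proof.
rewrite /Xi0 mx_of_mulmx// => c v w /=.
have -> : embed (c *: v + w) = c *: embed v + embed w.
  by apply/funext => -[|n]; rewrite !fctE //= scaler0 addr0.
by rewrite /= [toeplitz_rinv G _](R_linear _ (l2_embed hC v) (l2_embed hC w)).
Qed.

Lemma Theta0_ker_proj (u : 'cV[C]_p) :
  Theta0 *m Theta0 ^t* *m u = ker_proj g B Ainv u 0%N.
Proof.
have [-> _] := hTheta0; rewrite mulmxBl mul1mx; congr (_ - _).
have TE (v : 'cV[C]_p) : toeplitz G (embed v) = g_ v.
  by apply/funext => n; apply: conv_embed.
rewrite mx_of_mulmx /=; first by rewrite TE.
move=> c v w; rewrite /= !TE.
have -> : g_ (c *: v + w) = c *: g_ v + g_ w.
  by apply/funext => n; rewrite /symbol_col mulmxDr -scalemxAr.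
by rewrite [toeplitz_rinv G _](R_linear _ (@l2g v) (@l2g w)).
Qed.
Let Theta0_inj := hTheta0.2.

Definition Ycoef n : 'M[C]_p := mx_of (fun u => Ycol g B Ainv u n).

Lemma Ycoef_mul n u : Ycoef n *m u = Ycol g B Ainv u n.
Proof. by apply: mx_of_mulmx => c v w; apply: (Ycol_linear hC l2g TB AAinv). Qed.

Lemma has_mxtaylor_Y : has_mxtaylor (Y G) Ycoef.
Proof.
move=> i j z z1.
have lx := lR (l2_symbol_tail hC l2g (u := delta_mx j ord0)).
have -> : Y G z i j = (1%:M : 'M[C]_p) i j -
    z * coshift_resolvent z (R (coshift (g_ (delta_mx j ord0)))) 0%N i ord0.
  by rewrite /Y !mxE /= hankel_embed.
have h := coshift_resolvent_eval (i := i) lx z1.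
set x := R _ in h *.
have h' : (fun N => (1%:M : 'M[C]_p) i j -
      z * series (fun n => x n i ord0 * z ^+ n) N) @ \oo -->
    (1%:M : 'M[C]_p) i j - z * coshift_resolvent z x 0%N i ord0.
  by apply: cvgB; [exact: cvg_cst|exact: cvgMl_tmp].
rewrite -cvg_shiftS; apply: (cvg_ext h') => N.
rewrite seriesEnat [in RHS]seriesEnat /= big_nat_recl//=.
have YE n : Ycoef n i j = Ycol g B Ainv (delta_mx j ord0) n i ord0 by rewrite mxE.
rewrite YE Ycol0 expr0 mulr1 !mxE eqxx andbT; congr (_ + _).
rewrite mulr_sumr -sumrN; apply: eq_bigr => n _.
by rewrite YE YcolS mxE exprS; ring.
Qed.

Local Notation Xi := (fun z => Y G z *m Xi0 G).
Local Notation Theta := (fun z => Y G z *m Theta0).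
Local Notation TT := (conv (Theta_coef g B Ainv Theta0)).

Definition Xi_coef n := Ycoef n *m Xi0 G.

Lemma Xi_coef_mul n (e : 'cV[C]_m) : Xi_coef n *m e = R (embed e) n.
Proof.
by rewrite -mulmxA Xi0_mul Ycoef_mul -(rinv_embed hC l2g TB AAinv).
Qed.

Lemma has_mxtaylor_Xi : has_mxtaylor Xi Xi_coef.
Proof. exact: has_mxtaylorMr has_mxtaylor_Y. Qed.

Lemma has_mxtaylor_Theta : has_mxtaylor Theta (Theta_coef g B Ainv Theta0).
Proof. exact: has_mxtaylorMr has_mxtaylor_Y. Qed.

Lemma conv_mulmxr r s t l (a : nat -> 'M[C]_(r, s)) (b : nat -> 'M[C]_(s, t))
    (U : 'M[C]_(t, l)) n :
  conv a b n *m U = conv a (fun n => b n *m U) n.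
Proof. by rewrite /conv mulmx_suml; apply: eq_bigr => j _; rewrite mulmxA. Qed.

(** The coefficients of Xi + Theta V, where v are those of V. *)
Definition param_coef (v : nat -> 'M[C]_(k, m)) n := Xi_coef n + TT v n.

Lemma param_coef_mul v (e : 'cV[C]_m) :
  (fun n => param_coef v n *m e) = R (embed e) + TT (fun n => v n *m e).
Proof.
by apply/funext => n; rewrite mulmxDl Xi_coef_mul conv_mulmxr.
Qed.

Lemma has_mxtaylor_param V v : has_mxtaylor V v ->
  has_mxtaylor (fun z => Xi z + Theta z *m V z) (param_coef v).
Proof.
move=> Vv; apply: has_mxtaylorD has_mxtaylor_Xi _.
exact: (has_mxtaylorM hC has_mxtaylor_Theta Vv).
Qed.

Lemma mx_ext r s (A A' : 'M[C]_(r, s)) :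
  (forall e : 'cV[C]_s, A *m e = A' *m e) -> A = A'.
Proof.
move=> AA; apply/matrixP => i j; have := AA (delta_mx j ord0).
by rewrite -!colE => /colP/(_ i); rewrite !mxE.
Qed.

Lemma conv_solution (x : nat -> 'M[C]_(p, m)) :
  (forall e : 'cV[C]_m, T (fun n => x n *m e) = embed e) <->
  conv g x = (fun n => if n is 0%N then 1%:M else 0).
Proof.
split=> [h|h e].
  apply/funext => n; apply: mx_ext => e; rewrite conv_mulmxr h.
  by case: n => [|n]; rewrite ?mul1mx ?mul0mx.
apply/funext => n; rewrite -conv_mulmxr h.
by case: n => [|n]; rewrite ?mul1mx ?mul0mx.
Qed.

Lemma bezout_solutionP (X : C -> 'M[C]_(p, m)) x : has_mxtaylor X x ->
  (forall z, `|z| < 1 -> G z *m X z = 1%:M) <->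
  (forall e : 'cV[C]_m, T (fun n => x n *m e) = embed e).
Proof.
move=> Xx; have GX := has_mxtaylorM hC (Hinfmx_has_mxtaylor hG) Xx.
have c1 := @has_mxtaylor_cst C _ _ (1%:M : 'M[C]_m).
split=> [h|/conv_solution h z z1].
  apply/conv_solution; rewrite -(mxtaylorE GX).
  by apply: mxtaylorE; apply: (has_mxtaylor_ext c1) => z z1; rewrite h.
have := has_mxtaylor_inj GX; rewrite h => /(_ _ c1); exact.
Qed.

Lemma l2_param v : (forall e : 'cV[C]_m, l2 (fun n => v n *m e)) ->
  forall e : 'cV[C]_m, l2 (fun n => param_coef v n *m e).
Proof.
move=> lv e; rewrite param_coef_mul.
by have [] := pythagoras hC l2g TB AAinv Theta0_ker_proj Theta0_inj e (lv e).
Qed.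

Lemma H2mx_of_l2 r s (F : C -> 'M[C]_(r, s)) a : has_mxtaylor F a ->
  (forall e : 'cV[C]_s, l2 (fun n => a n *m e)) -> H2mx F.
Proof.
move=> Fa la; apply: (H2mx_of_l2_cols hC Fa) => j.
have -> : (fun n => col j (a n)) = (fun n => a n *m delta_mx j ord0).
  by apply/funext => n; rewrite colE.
exact: la.
Qed.

Lemma param_solution V :
  H2mx V -> bezout_solution G (fun z => Xi z + Theta z *m V z).
Proof.
move=> hV; have lv e := H2mx_l2 hC (u := e) hV.
have Xx := has_mxtaylor_param (H2mx_has_mxtaylor hV).
split; first by apply: (H2mx_of_l2 Xx); apply: l2_param.
apply/(bezout_solutionP Xx) => e; rewrite param_coef_mul.
exact: (conv_rinv_Theta hC l2g TB AAinv Theta0_ker_proj Theta0_inj e (lv e)).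
Qed.

Lemma solution_param X : bezout_solution G X -> exists V,
  H2mx V /\ forall z, `|z| < 1 -> X z = Xi z + Theta z *m V z.
Proof.
move=> [hX GX]; have Xx := H2mx_has_mxtaylor hX.
have TX := (bezout_solutionP Xx).1 GX.
have /boolp.choice[s hs] : forall j : 'I_m, exists s : nat -> 'cV[C]_k, l2 s /\
    TT s = (fun n => mxtaylor X n *m delta_mx j ord0) - R (embed (delta_mx j ord0)).
  move=> j; set e : 'cV[C]_m := delta_mx j ord0; have le := l2_embed hC e.
  have lX : l2 (fun n => mxtaylor X n *m e) by apply: H2mx_l2.
  have [||s ls TTs] := conv_Theta_onto hC l2g TB AAinv Theta0_ker_proj Theta0_inj
    (y := (fun n => mxtaylor X n *m e) - R (embed e)).
  - by apply: l2B => //; apply: lR.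
  - by rewrite convB TX (rinvK AAinv)// subrr.
  by exists s.
pose v n : 'M[C]_(k, m) := \matrix_(i, j) s j n i ord0.
have vcol j : (fun n => v n *m delta_mx j ord0) = s j.
  by apply/funext => n; rewrite -colE; apply/colP => i; rewrite !mxE.
have lv j : l2 (fun n => col j (v n)).
  have -> : (fun n => col j (v n)) = s j.
    by apply/funext => n; apply/colP => i; rewrite !mxE.
  by have [] := hs j.
have Vv := l2_has_mxtaylor hC lv; eexists; split; first exact: H2mx_of_l2_cols Vv lv.
apply: (has_mxtaylor_inj Xx); have := has_mxtaylor_param Vv.
congr (has_mxtaylor _ _); apply/funext => n; apply/matrixP => i j.
have := congr1 (fun f : nat -> 'cV[C]_p => f n i ord0)
  (param_coef_mul v (delta_mx j ord0)).
rewrite /= -colE mxE => ->; rewrite vcol (hs j).2.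
by rewrite addrC subrK -colE mxE.
Qed.

Lemma h2norm_sqE n (h : C -> 'cV[C]_n) a : has_mxtaylor h a ->
  h2norm h ^+ 2 = l2dot a a.
Proof. by move=> ha; rewrite /h2norm (mxtaylorE ha) sqrtCK. Qed.

Lemma h2norm_param V : H2mx V -> forall u : 'cV[C]_m,
  h2norm (fun z => (Xi z + Theta z *m V z) *m u) ^+ 2 =
  h2norm (fun z => Xi z *m u) ^+ 2 + h2norm (fun z => V z *m u) ^+ 2.
Proof.
move=> hV u; have Vv := H2mx_has_mxtaylor hV; have lv := H2mx_l2 hC (u := u) hV.
have := pythagoras hC l2g TB AAinv Theta0_ker_proj Theta0_inj u lv.
rewrite -param_coef_mul => -[lX nX].
have cX := has_mxtaylorMr hC (U := u) (has_mxtaylor_param Vv).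
have cXi : has_mxtaylor (fun z => Xi z *m u) (R (embed u)).
  have -> : R (embed u) = (fun n => Xi_coef n *m u).
    by apply/funext => n; rewrite Xi_coef_mul.
  exact: has_mxtaylorMr has_mxtaylor_Xi.
have cV := has_mxtaylorMr hC (U := u) Vv.
exact: etrans (h2norm_sqE cX)
  (etrans nX (esym (congr2 +%R (h2norm_sqE cXi) (h2norm_sqE cV)))).
Qed.

Lemma h2norm_ge0 n (h : C -> 'cV[C]_n) : l2 (mxtaylor h) -> 0 <= h2norm h.
Proof. by move=> lh; rewrite /h2norm /l2norm sqrtC_ge0 l2dot_ge0. Qed.

Lemma H2mx0 r s : H2mx (fun _ : C => 0 : 'M[C]_(r, s)).
Proof.
apply: (H2mx_of_l2 (@has_mxtaylor_cst C _ _ 0)) => e.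
rewrite (_ : (fun n => _) = 0); first exact: l20.
by apply/funext => -[|n]; rewrite mul0mx.
Qed.

Lemma Xi_solution : bezout_solution G Xi.
Proof.
have := param_solution (@H2mx0 k m).
by congr (bezout_solution G _); apply/funext => z; rewrite mulmx0 addr0.
Qed.

Lemma solution_h2norm_ge0 X (u : 'cV[C]_m) :
  bezout_solution G X -> 0 <= h2norm (fun z => X z *m u).
Proof.
move=> [hX _]; have Xx := H2mx_has_mxtaylor hX; apply: h2norm_ge0.
by rewrite (mxtaylorE (has_mxtaylorMr hC (U := u) Xx)); apply: H2mx_l2.
Qed.

Lemma h2norm_ext n (h h' : C -> 'cV[C]_n) a : has_mxtaylor h a ->
  (forall z, `|z| < 1 -> h z = h' z) -> h2norm h = h2norm h'.
Proof.
move=> ha hh'.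
by rewrite /h2norm (mxtaylorE ha) (mxtaylorE (has_mxtaylor_ext ha hh')).
Qed.

Lemma h2norm_solution X V (u : 'cV[C]_m) : bezout_solution G X -> H2mx V ->
  (forall z, `|z| < 1 -> X z = Xi z + Theta z *m V z) ->
  h2norm (fun z => X z *m u) ^+ 2 =
  h2norm (fun z => Xi z *m u) ^+ 2 + h2norm (fun z => V z *m u) ^+ 2.
Proof.
move=> [hX _] hV XV.
have e : h2norm (fun z => X z *m u) =
         h2norm (fun z => (Xi z + Theta z *m V z) *m u).
  have cX := has_mxtaylorMr hC (U := u) (H2mx_has_mxtaylor hX).
  by apply: (h2norm_ext cX) => z z1; rewrite XV.
exact: etrans (congr1 (fun x => x ^+ 2) e) (h2norm_param hV u).
Qed.

Let le_of_sq (a b d : C) :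
  0 <= a -> 0 <= b -> b ^+ 2 = a ^+ 2 + d -> 0 <= d -> a <= b.
Proof. by move=> a0 b0 e d0; rewrite -ler_sqr ?nnegrE// e lerDl. Qed.

Let eq0_of_sq (a b d : C) :
  0 <= b -> b <= a -> b ^+ 2 = a ^+ 2 + d -> 0 <= d -> d = 0.
Proof.
move=> b0 ba e d0; apply/eqP; rewrite eq_le d0 andbT.
rewrite -(lerD2l (a ^+ 2)) addr0 -e ler_sqr ?nnegrE//.
exact: le_trans ba.
Qed.

Lemma Xi_least_squares : least_squares_solution G Xi.
Proof.
split=> [|X solX u]; first exact: Xi_solution.
have [V [hV XV]] := solution_param solX.
have lV : l2 (fun n => mxtaylor V n *m u) by apply: H2mx_l2.
have nV := h2norm_sqE (has_mxtaylorMr hC (U := u) (H2mx_has_mxtaylor hV)).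
have nX := etrans (h2norm_solution u solX hV XV) (congr1 (+%R _) nV).
exact: (le_of_sq (solution_h2norm_ge0 u Xi_solution)
  (solution_h2norm_ge0 u solX) nX (l2dot_ge0 lV)).
Qed.

Lemma least_squares_unique X : least_squares_solution G X ->
  forall z, `|z| < 1 -> X z = Xi z.
Proof.
move=> [solX minX]; have [V [hV XV]] := solution_param solX.
have Vv := H2mx_has_mxtaylor hV.
have v0 : mxtaylor V = (fun n => if n is 0%N then 0 else 0).
  apply/funext => n; apply: mx_ext => e.
  rewrite [RHS](_ : _ = 0); last by case: n => [|n]; rewrite mul0mx.
  have lv : l2 (fun n => mxtaylor V n *m e) by apply: H2mx_l2.
  have nV := h2norm_sqE (has_mxtaylorMr hC (U := e) Vv).
  have nX := etrans (h2norm_solution e solX hV XV) (congr1 (+%R _) nV).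
  have v0 := eq0_of_sq (solution_h2norm_ge0 e solX) (minX _ Xi_solution e) nX
    (l2dot_ge0 lv).
  exact: (congr1 (fun f : nat -> 'cV[C]_k => f n) (l2dot_eq0 lv v0)).
rewrite v0 in Vv => z z1; rewrite XV//.
by rewrite (has_mxtaylor_inj Vv (@has_mxtaylor_cst C _ _ 0) z1) mulmx0 addr0.
Qed.

Lemma toeplitz_Theta : toeplitz Theta = TT.
Proof. by apply/funext => x; rewrite -(mxtaylorE has_mxtaylor_Theta). Qed.

Lemma Theta_isometry : isometry_l2 (toeplitz Theta).
Proof.
move=> x lx; rewrite toeplitz_Theta.
have [lT _ _] := conv_Theta_l2 hC l2g TB AAinv Theta0_ker_proj Theta0_inj lx.
by rewrite /l2norm (conv_Theta_isometry hC l2g TB AAinv Theta0_ker_proj Theta0_inj lx).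
Qed.

Lemma Theta_image : toeplitz Theta @` l2 =
  l2 `&` [set y | toeplitz G y = (fun _ : nat => 0)].
Proof.
rewrite toeplitz_Theta; apply/seteqP; split=> [_ [x lx <-]|y [ly Ty]].
  by have [lT T0 _] := conv_Theta_l2 hC l2g TB AAinv Theta0_ker_proj Theta0_inj lx.
have [x lx <-] := conv_Theta_onto hC l2g TB AAinv Theta0_ker_proj Theta0_inj ly Ty.
by exists x.
Qed.
End Assembly.

(** * Boundedness of inner functions *)

Section ContractionBound.
Variables (C : numClosedFieldType) (r s : nat).
Hypothesis hC : order_complete C.

(** The reproducing kernel of l2 at z: the inner product with it evaluates an
    entry of a power series at z. *)
Definition kernel_vec n (z : C) (i : 'I_n) : nat -> 'cV[C]_n :=
  fun l => (z^*) ^+ l *: delta_mx i ord0.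

Lemma vdot_delta n (u : 'cV[C]_n) i : vdot u (delta_mx i ord0) = u i ord0.
Proof.
rewrite vdotE (bigD1 i)//= big1 ?addr0 ?mxE ?eqxx ?conjC1 ?mulr1// => j ji.
by rewrite mxE (negPf ji) conjC0 mulr0.
Qed.

Lemma l2_kernel_vec n z (i : 'I_n) : `|z| < 1 -> l2 (kernel_vec z i).
Proof.
move=> z1; have nz1 : `|z| ^+ 2 < 1 by rewrite expr_lt1.
apply: (l2_bounded hC (M := 1 / (1 - `|z| ^+ 2))) => N.
have z2 : 0 <= `|z| ^+ 2 by rewrite exprn_ge0.
have h l : `|vdot (kernel_vec z i l) (kernel_vec z i l)| <= 1 * (`|z| ^+ 2) ^+ l.
  rewrite vdotZl vdotZr vdot_delta mxE !eqxx mulr1 -normCK mul1r.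
  by rewrite ger0_norm ?exprn_ge0// normrX norm_conjC -!exprM mulnC.
apply: le_trans (absum_geometric z2 nz1 h N); rewrite big_mkord.
by apply: ler_sum => l _; apply: real_ler_norm; apply: ger0_real; apply: vdot_ge0.
Qed.

(** With kernels x and y for the indices j and i, <F x, y> is the entry i of
    F(z) x(z) = |x|^2 F(z) e_j; Cauchy-Schwarz bounds it by |x| |y| = |x|^2. *)
Lemma isometry_entry_le (F : C -> 'M[C]_(r, s)) a z i j : has_mxtaylor F a ->
  isometry_l2 (conv a) -> `|z| < 1 -> `|F z i j| <= 1.
Proof.
move=> Fa isoF z1.
have lx := l2_kernel_vec (i := j) z1; have ly := l2_kernel_vec (i := i) z1.
set x := kernel_vec z j in lx; set y := kernel_vec z i in ly.
have [lFx nFx] := isoF _ lx.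
have xy n n' (i' : 'I_n) (j' : 'I_n') :
  l2dot (kernel_vec z i') (kernel_vec z i') =
  l2dot (kernel_vec z j') (kernel_vec z j').
  rewrite /l2dot; congr (limn (series _)); apply/funext => l.
  by rewrite !vdotZl !vdotZr !vdot_delta !mxE !eqxx.
set S := l2dot y y.
have xS : l2dot x x = S by apply: xy.
pose xf := fun w : C =>
  \matrix_(i', j') limn (series (fun n => x n i' j' * w ^+ n)).
have xfx : has_mxtaylor xf x.
  apply: (l2_has_mxtaylor hC) => j'; rewrite (_ : (fun n => _) = x)//.
  by apply/funext => n; apply/colP => l; rewrite mxE ord1.
have xz : xf z = S *: delta_mx j ord0.
  apply/colP => l.
  have -> : (S *: delta_mx j ord0 : 'cV[C]_s) l ord0 = l2dot x x * (l == j)%:R.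
    by rewrite xS !mxE andbT.
  apply: (cvgn_unique (xfx l ord0 z z1)).
  apply: (cvg_ext (cvgMr_tmp (b := (l == j)%:R) (cvg_l2dot hC lx lx))) => N.
  rewrite !seriesEnat /= mulr_suml; apply: eq_bigr => n _.
  rewrite vdotZl vdotZr vdot_delta !mxE !eqxx rmorphXn /= conjCK mulr1.
  by rewrite andbT mulrAC.
have Fx := has_mxtaylorM hC Fa xfx.
have TS : l2dot (conv a x) y = S * F z i j.
  apply: cvgn_unique (cvg_l2dot hC lFx ly) _.
  have -> : S * F z i j = (F z *m xf z) i ord0.
    by rewrite xz -scalemxAr mxE -colE mxE.
  apply: (cvg_ext (Fx i ord0 z z1)) => N; rewrite !seriesEnat /=.
  by apply: eq_bigr => n _; rewrite vdotZr vdot_delta rmorphXn /= conjCK mulrC.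
have S1 : 1 <= S.
  apply: le_trans (l2_entry_le 0 ly).
  by rewrite vdotZl vdotZr vdot_delta !mxE !eqxx expr0 conjC1 !mul1r.
have S0 : 0 < S by apply: lt_le_trans S1.
have := l2_cauchy_schwarz hC lFx ly.
have -> : l2dot (conv a x) (conv a x) = S.
  by rewrite -xS -[LHS]sqrtCK -[RHS]sqrtCK -/(l2norm _) nFx.
rewrite TS normrM (gtr0_norm S0) exprMn expr2 -/S ger_pMr ?mulr_gt0//.
by rewrite expr_le1.
Qed.
End ContractionBound.

(** * The theorem *)

Theorem bezout_h2 (C : numClosedFieldType) (m p k : nat)
    (G : C -> 'M[C]_(m, p)) (Theta0 : 'M[C]_(p, k)) :
  order_complete C ->
  Hinfmx G ->
  strictly_positive (gram G) ->
  is_Theta0 G Theta0 ->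
  let Xi := fun z : C => Y G z *m Xi0 G in
  let Theta := fun z : C => Y G z *m Theta0 in
  [/\ H2mx Xi,
      [/\ (m <= p)%N, k = (p - m)%N, inner Theta &
          toeplitz Theta @` l2 =
          l2 `&` [set y | toeplitz G y = (fun _ : nat => 0)]],
      (forall V : C -> 'M[C]_(k, m), H2mx V ->
         bezout_solution G (fun z => Xi z + Theta z *m V z)),
      (forall X : C -> 'M[C]_(p, m), bezout_solution G X ->
         exists V : C -> 'M[C]_(k, m),
           H2mx V /\
           forall z : C, `|z| < 1 -> X z = Xi z + Theta z *m V z) &
      (forall (V : C -> 'M[C]_(k, m)), H2mx V ->
         forall u : 'cV[C]_m,
         h2norm (fun z => (Xi z + Theta z *m V z) *m u) ^+ 2 =
         h2norm (fun z => Xi z *m u) ^+ 2 + h2norm (fun z => V z *m u) ^+ 2)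
      /\ (least_squares_solution G Xi /\
          (forall X : C -> 'M[C]_(p, m), least_squares_solution G X ->
             forall z : C, `|z| < 1 -> X z = Xi z))].
Proof.
move=> hC hG posG hT Xi Theta.
have [mp kpm] := Theta_size hC (fun u => Hinfmx_l2 hC hG)
  (is_adjoint_toeplitz hC posG) (is_inverse_gram hC hG posG)
  (Theta0_ker_proj hC hG posG hT) hT.2.
have isoT := Theta_isometry hC hG posG hT.
have hTheta := has_mxtaylor_Theta hC (Theta0 := Theta0) hG posG.
split; first by have [] := Xi_solution hC hG posG hT.
- split=> //; last exact: (Theta_image hC hG posG hT).
  split=> // i j; split; first by eexists; exact: hTheta.
  exists 1 => z z1; have isoC := isoT.
  rewrite (toeplitz_Theta hC _ hG posG) in isoC.
  exact: (@isometry_entry_le _ _ _ hC _ _ z i j hTheta isoC z1).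
- exact: (param_solution hC hG posG hT).
- exact: (solution_param hC hG posG hT).
split; first exact: (h2norm_param hC hG posG hT).
split; first exact: (Xi_least_squares hC hG posG hT).
exact: (least_squares_unique hC hG posG hT).
Qed.

(** Suprema are taken on real parts. *)
Lemma complex_order_complete (R : realType) :
  order_complete (R[i] : numClosedFieldType).
Proof.
move=> A [a0 Aa0] A0 [M AM].
pose S : set R := [set @complex.Re R x | x in A].
have AR x : A x -> x = ((complex.Re x)%:C)%C.
  by move=> /A0 x0; rewrite complex.RRe_real ?ger0_real.
have M0 : 0 <= M := le_trans (A0 _ Aa0) (AM _ Aa0).
have MR : M = ((complex.Re M)%:C)%C by rewrite complex.RRe_real ?ger0_real.
have hS : has_sup S.
  split; first by exists (complex.Re a0), a0.
  exists (complex.Re M) => _ [x Ax <-].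
  by have := AM x Ax; rewrite (AR x Ax) MR complex.lecR.
exists ((sup S)%:C)%C; split=> [x Ax|K AK].
  rewrite (AR x Ax) complex.lecR; apply: sup_upper_bound => //; by exists x.
have KR : K = ((complex.Re K)%:C)%C.
  by rewrite complex.RRe_real ?ger0_real// (le_trans (A0 _ Aa0) (AK _ Aa0)).
rewrite KR complex.lecR; apply: sup_le_ub; first by case: hS.
move=> _ [x Ax <-]; have := AK x Ax; by rewrite (AR x Ax) KR complex.lecR.
Qed.

Local Open Scope complex_scope.

Theorem theorem4p1 (R : realType) (m p k : nat)
    (G : R[i] -> 'M[R[i]]_(m, p)) (Theta0 : 'M[R[i]]_(p, k)) :
  Hinfmx G ->
  strictly_positive (gram G) ->
  is_Theta0 G Theta0 ->
  let Xi := fun z : R[i] => Y G z *m Xi0 G in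
  let Theta := fun z : R[i] => Y G z *m Theta0 in
  [/\ H2mx Xi,
      [/\ (m <= p)%N, k = (p - m)%N, inner Theta &
          toeplitz Theta @` l2 =
          l2 `&` [set y | toeplitz G y = (fun _ : nat => 0)]],
      (forall V : R[i] -> 'M[R[i]]_(k, m), H2mx V ->
         bezout_solution G (fun z => Xi z + Theta z *m V z)),
      (forall X : R[i] -> 'M[R[i]]_(p, m), bezout_solution G X ->
         exists V : R[i] -> 'M[R[i]]_(k, m),
           H2mx V /\
           forall z : R[i], `|z| < 1 -> X z = Xi z + Theta z *m V z) &
      (forall (V : R[i] -> 'M[R[i]]_(k, m)), H2mx V ->
         forall u : 'cV[R[i]]_m,
         h2norm (fun z => (Xi z + Theta z *m V z) *m u) ^+ 2 =
         h2norm (fun z => Xi z *m u) ^+ 2 + h2norm (fun z => V z *m u) ^+ 2)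
      /\ (least_squares_solution G Xi /\
          (forall X : R[i] -> 'M[R[i]]_(p, m), least_squares_solution G X ->
             forall z : R[i], `|z| < 1 -> X z = Xi z))].
Proof.
move=> hG posG hT.
exact: (bezout_h2 (@complex_order_complete R) hG posG hT).
Qed.
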